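(* Let $\ell\ge0$ and let $W_{GL_{\ell+1}}(\mathbb H)$ be the quaternionic Weyl group. There is a group extension $$1\longrightarrow(\mu_2)^{\ell+1}\longrightarrow\widetilde W_{GL_{\ell+1}}(\mathbb H)\longrightarrow W_{GL_{\ell+1}}(\mathbb H)\longrightarrow1,\qquad \mu_2=\{\pm1\},$$ such that $\widetilde W_{GL_{\ell+1}}(\mathbb H)$ admits a natural embedding $\widetilde W_{GL_{\ell+1}}(\mathbb H)\subset GL_{\ell+1}(\mathbb H)$ (i.e. one under which the projection to $W_{GL_{\ell+1}}(\mathbb H)$ is given by the conjugation action on the diagonal subgroup $H_{\mathbb H}$). The Tits group extension $$1\longrightarrow(\mu_2)^{\ell+1}\longrightarrow W^T_{Sp_{2\ell+2}}\longrightarrow W_{Sp_{2\ell+2}}\longrightarrow1$$ is obtained by restriction of this extension to the subgroup $W_{Sp_{2\ell+2}}\subset W_{GL_{\ell+1}}(\mathbb H)$.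
   Context: $\mathbb H$ is the algebra of quaternions with units $\imath,\jmath,k$, and $\mathbb C=\mathbb R\oplus\mathbb R\imath\subset\mathbb H$. $H_{\mathbb H}=(\mathbb H^* )^{\ell+1}\subset GL_{\ell+1}(\mathbb H)$ is the subgroup of invertible diagonal matrices. The quaternionic Weyl group $W_{GL_{\ell+1}}(\mathbb H)$ is the group of automorphisms of $H_{\mathbb H}$ induced by conjugation by elements of $GL_{\ell+1}(\mathbb H)$ normalizing $H_{\mathbb H}$; it equals $\mathfrak S_{\ell+1}\ltimes \mathrm{Aut}(\mathbb H)^{\ell+1}$, where $\mathrm{Aut}(\mathbb H)=\mathbb H^*/\mathbb R^*\simeq SO_3(\mathbb R)$. The Weyl group of $Sp_{2\ell+2}$ is $W_{Sp_{2\ell+2}}=W(C_{\ell+1})=\mathfrak S_{\ell+1}\ltimes(\mathbb Z/2\mathbb Z)^{\ell+1}$; it is embedded in $W_{GL_{\ell+1}}(\mathbb H)$ as the identity on $\mathfrak S_{\ell+1}$ and by sending the generator of each factor $\mathbb Z/2\mathbb Z=\mathrm{Gal}(\mathbb C/\mathbb R)$ to the automorphism $q\mapsto\jmath q\jmath^{-1}$ of $\mathbb H$ (which restricts to complex conjugation on $\mathbb C$) in the corresponding factor $\mathrm{Aut}(\mathbb H)$. The Tits group $W^T_{Sp_{2m}}$, $m=\ell+1$, is the subgroup of $Sp_{2m}(\mathbb C)$ generated by $\exp\left(\frac\pi2(f_i-e_i)\right)$, $1\le i\le m$, where $e_i,f_i$ are Chevalley generators of $\mathfrak{sp}_{2m}$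 for the simple roots; it is contained in the normalizer of the maximal torus $H$ and is an extension of $W(C_m)$ by the group $H^{(2)}\simeq(\mu_2)^m$ of 2-torsion elements of $H$. *)

(* Defs.v *)
From HB Require Import structures.
From mathcomp Require Import all_boot all_order all_algebra all_fingroup.
From mathcomp Require Import complex ring.
From mathcomp Require Import all_classical all_reals all_analysis.
Set Implicit Arguments.
Unset Strict Implicit.
Unset Printing Implicit Defensive.
Import GRing.Theory Num.Theory.
Import numFieldNormedType.Exports.
Local Open Scope classical_set_scope.
Local Open Scope ring_scope.

(* [Quat a b c d] is a + b i + c j + d k. *)
Record quat (R : Type) := Quat { qre : R; qi : R; qj : R; qk : R }.

Section QuatRing.
Variable R : comNzRingType.
Implicit Types x y z : quat R.

Let enc x := (qre x, qi x, qj x, qk x).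
Let dec (t : R * R * R * R) :=
  let: (a, b, c, d) := t in Quat a b c d.
Let encK : cancel enc dec. Proof. by case. Qed.

HB.instance Definition _ := Choice.copy (quat R) (can_type encK).

Definition quat_zero : quat R := Quat 0 0 0 0.
Definition quat_opp x := Quat (- qre x) (- qi x) (- qj x) (- qk x).
Definition quat_add x y :=
  Quat (qre x + qre y) (qi x + qi y) (qj x + qj y) (qk x + qk y).
Definition quat_one : quat R := Quat 1 0 0 0.
Definition quat_mul x y :=
  let: Quat a b c d := x in let: Quat a' b' c' d' := y in
  Quat (a * a' - b * b' - c * c' - d * d')
       (a * b' + b * a' + c * d' - d * c')
       (a * c' - b * d' + c * a' + d * b')
       (a * d' + b * c' - c * b' + d * a').

Fact quat_addA : associative quat_add.
Proof. by move=> x y z; congr Quat; rewrite /= addrA. Qed.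
Fact quat_addC : commutative quat_add.
Proof. by move=> x y; congr Quat; rewrite /= addrC. Qed.
Fact quat_add0 : left_id quat_zero quat_add.
Proof. by case=> *; congr Quat; rewrite /= add0r. Qed.
Fact quat_addN : left_inverse quat_zero quat_opp quat_add.
Proof. by move=> x; congr Quat; rewrite /= addNr. Qed.

HB.instance Definition _ :=
  GRing.isZmodule.Build (quat R) quat_addA quat_addC quat_add0 quat_addN.

Fact quat_mulA : associative quat_mul.
Proof. by case=> ????[]????[]????; congr Quat; ring. Qed.
Fact quat_mul1 : left_id quat_one quat_mul.
Proof. by case=> ????; congr Quat; ring. Qed.
Fact quat_mulr1 : right_id quat_one quat_mul.
Proof. by case=> ????; congr Quat; ring. Qed.
Fact quat_mulDl : left_distributive quat_mul +%R.
Proof. by case=> ????[]????[]????; congr Quat => /=; ring. Qed.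
Fact quat_mulDr : right_distributive quat_mul +%R.
Proof. by case=> ????[]????[]????; congr Quat => /=; ring. Qed.
Fact quat_one_neq0 : quat_one != 0.
Proof. by apply/eqP => -[] /eqP; rewrite oner_eq0. Qed.

HB.instance Definition _ := GRing.Zmodule_isNzRing.Build (quat R)
  quat_mulA quat_mul1 quat_mulr1 quat_mulDl quat_mulDr quat_one_neq0.

Definition quatj : quat R := Quat 0 0 1 0.

End QuatRing.

(* The group of units of a ring.  The library's [GRing.unit] is not available
   for matrices over a noncommutative ring. *)
Record units (R : pzRingType) := Units {
  uval : R;
  uinv : R;
  uvalK : uval * uinv = 1;
  uinvK : uinv * uval = 1 }.

HB.instance Definition _ (R : pzRingType) := gen_eqMixin (units R).
HB.instance Definition _ (R : pzRingType) := gen_choiceMixin (units R).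

Section UnitsGroup.
Variable R : pzRingType.
Implicit Types x y z : units R.

Lemma units_eq x y : uval x = uval y -> x = y.
Proof.
case: x y => [a a' aK a'K] [b b' bK b'K] /= eab; subst b.
have eab' : a' = b' by rewrite -[a']mulr1 -bK mulrA a'K mul1r.
by subst b'; congr Units; exact: Prop_irrelevance.
Qed.

Fact units_mul_subproof x y : uval x * uval y * (uinv y * uinv x) = 1.
Proof. by rewrite mulrA -(mulrA (uval x)) uvalK mulr1 uvalK. Qed.
Fact units_mul_subproof' x y : uinv y * uinv x * (uval x * uval y) = 1.
Proof. by rewrite mulrA -(mulrA (uinv y)) uinvK mulr1 uinvK. Qed.

Definition units_one : units R := Units (mulr1 1) (mulr1 1).
Definition units_inv x : units R := Units (uinvK x) (uvalK x).
Definition units_mul x y : units R :=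
  Units (units_mul_subproof x y) (units_mul_subproof' x y).

Fact units_mulA : associative units_mul.
Proof. by move=> x y z; apply: units_eq; rewrite /= mulrA. Qed.
Fact units_mul1 : left_id units_one units_mul.
Proof. by move=> x; apply: units_eq; rewrite /= mul1r. Qed.
Fact units_mulr1 : right_id units_one units_mul.
Proof. by move=> x; apply: units_eq; rewrite /= mulr1. Qed.
Fact units_mulV : left_inverse units_one units_inv units_mul.
Proof. by move=> x; apply: units_eq; rewrite /= uinvK. Qed.
Fact units_mulrV : right_inverse units_one units_inv units_mul.
Proof. by move=> x; apply: units_eq; rewrite /= uvalK. Qed.

HB.instance Definition _ := isGroup.Build (units R)
  units_mulA units_mul1 units_mulr1 units_mulV units_mulrV.

End UnitsGroup.

Local Open Scope group_scope.

Record subgroup (G : groupType) := Subgroup {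
  sg_set : set G;
  sg_one : sg_set 1;
  sg_mul : forall x y, sg_set x -> sg_set y -> sg_set (x * y);
  sg_inv : forall x, sg_set x -> sg_set x^-1 }.

(* A subgroup as a group in its own right; [val] is the inclusion. *)
Definition sgtype (G : groupType) (T : subgroup G) := {x : G | x \in sg_set T}.

Section SubgroupType.
Variables (G : groupType) (T : subgroup G).

Fact sg_group_closed : group_closed (fun x : G => x \in sg_set T).
Proof.
split=> [|x y]; first by apply/mem_set/sg_one.
by move=> /set_mem Tx /set_mem Ty; apply/mem_set/sg_mul => //; apply/sg_inv.
Qed.

HB.instance Definition _ := SubType.on (sgtype T).
HB.instance Definition _ := Choice.on (sgtype T).
HB.instance Definition _ :=
  SubChoice_isSubGroup.Build G _ (sgtype T) sg_group_closed.

End SubgroupType.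

Definition generated (G : groupType) (S : set G) : subgroup G.
Proof.
exists [set x | forall K : subgroup G, S `<=` sg_set K -> sg_set K x].
- by move=> K _; exact: sg_one.
- by move=> x y Hx Hy K SK; apply: sg_mul; [exact: Hx | exact: Hy].
- by move=> x Hx K SK; apply/sg_inv/Hx.
Defined.

Record aut (G : groupType) := Aut {
  aut_fun :> G -> G;
  aut_inv : G -> G;
  aut_funK : cancel aut_fun aut_inv;
  aut_invK : cancel aut_inv aut_fun;
  aut_morph : forall x y, aut_fun (x * y) = aut_fun x * aut_fun y }.

HB.instance Definition _ (G : groupType) := gen_eqMixin (aut G).
HB.instance Definition _ (G : groupType) := gen_choiceMixin (aut G).

Section AutGroup.
Variable G : groupType.
Implicit Types f g h : aut G.

Lemma aut_eq f g : f =1 g -> f = g.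
Proof.
case: f g => [f f' fK f'K fM] [g g' gK g'K gM] /= /funext efg; subst g.
have e : f' = g' by apply/funext => x; rewrite -{1}(g'K x) fK.
by subst g'; congr Aut; exact: Prop_irrelevance.
Qed.

Fact aut_inv_morph f x y : aut_inv f (x * y) = aut_inv f x * aut_inv f y.
Proof. by apply: (can_inj (aut_funK f)); rewrite aut_morph !aut_invK. Qed.
Fact aut_comp_morph f g x y : f (g (x * y)) = f (g x) * f (g y).
Proof. by rewrite !aut_morph. Qed.

Definition aut_id : aut G := @Aut G id id (frefl _) (frefl _) (fun _ _ => erefl).
Definition aut_inverse f : aut G := Aut (aut_invK f) (aut_funK f) (aut_inv_morph f).
Definition aut_comp f g : aut G :=
  @Aut G (f \o g) (aut_inv g \o aut_inv f)
    (can_comp (aut_funK f) (aut_funK g)) (can_comp (aut_invK g) (aut_invK f))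
    (aut_comp_morph f g).

Fact aut_compA : associative aut_comp.
Proof. by move=> f g h; exact: aut_eq. Qed.
Fact aut_comp1 : left_id aut_id aut_comp.
Proof. by move=> f; exact: aut_eq. Qed.
Fact aut_compr1 : right_id aut_id aut_comp.
Proof. by move=> f; exact: aut_eq. Qed.
Fact aut_compV : left_inverse aut_id aut_inverse aut_comp.
Proof. by move=> f; apply: aut_eq => x; rewrite /= aut_funK. Qed.
Fact aut_comprV : right_inverse aut_id aut_inverse aut_comp.
Proof. by move=> f; apply: aut_eq => x; rewrite /= aut_invK. Qed.

HB.instance Definition _ := isGroup.Build (aut G)
  aut_compA aut_comp1 aut_compr1 aut_compV aut_comprV.

End AutGroup.

Section Weyl.
Variables (G : groupType) (T : subgroup G).

Definition normalizes (g : G) := forall h, sg_set T (g * h * g^-1) <-> sg_set T h.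

Definition induced_by (g : G) (f : aut (sgtype T)) :=
  forall h, val (f h) = g * val h * g^-1.

Definition weyl : subgroup (aut (sgtype T)).
Proof.
exists [set f | exists2 g, normalizes g & induced_by g f].
- by exists 1 => h; rewrite invg1 mul1g mulg1.
- move=> f f' [g gN gf] [g' gN' gf']; exists (g * g') => h.
    by rewrite -(gN' h) -(gN (g' * h * g'^-1)) invgM !mulgA.
  by rewrite /= gf gf' invgM !mulgA.
- move=> f [g gN gf]; exists g^-1 => h.
    by rewrite -[X in X <-> _]gN invgK !mulgA mulgV mul1g mulgK.
  by rewrite -{2}[h](aut_invK f) gf invgK !mulgA mulVg mul1g mulgKV.
Defined.

Section Conjugation.
Variables (g : G) (gN : normalizes g).

Fact conj_subproof (h : sgtype T) : g * val h * g^-1 \in sg_set T.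
Proof. by apply/mem_set/gN/set_mem/valP. Qed.
Fact conj_subproof' (h : sgtype T) : g^-1 * val h * g \in sg_set T.
Proof.
by apply/mem_set; rewrite -gN !mulgA mulgV mul1g mulgK; exact/set_mem/valP.
Qed.

Definition conj_fun (h : sgtype T) : sgtype T := exist (fun x => x \in sg_set T) _ (conj_subproof h).
Definition conj_inv (h : sgtype T) : sgtype T := exist (fun x => x \in sg_set T) _ (conj_subproof' h).

Fact conj_funK : cancel conj_fun conj_inv.
Proof.
by move=> h; apply: val_inj; rewrite /= !mulgA mulVg mul1g mulgKV.
Qed.
Fact conj_invK : cancel conj_inv conj_fun.
Proof.
by move=> h; apply: val_inj; rewrite /= !mulgA mulgV mul1g mulgK.
Qed.
Fact conj_morph x y : conj_fun (x * y) = conj_fun x * conj_fun y.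
Proof.
apply: val_inj; change (g * (val x * val y) * g^-1 =
  g * val x * g^-1 * (g * val y * g^-1)).
by rewrite !mulgA mulgKV.
Qed.

Definition conj_aut : aut (sgtype T) := Aut conj_funK conj_invK conj_morph.

Fact conj_aut_weyl : conj_aut \in sg_set weyl.
Proof. by apply/mem_set; exists g. Qed.

Definition weyl_conj : sgtype weyl := exist (fun f => f \in sg_set weyl) conj_aut conj_aut_weyl.

End Conjugation.

End Weyl.

Definition is_extension (A E W : groupType)
    (i : {multiplicative A -> E}) (p : {multiplicative E -> W}) :=
  [/\ injective i, (forall w, exists x, p x = w)
    & forall x, p x = 1 <-> exists a, i a = x].

(* 1 -> A -> E' -> W' -> 1 is the restriction of 1 -> A -> E -> W -> 1 along
   u : W' -> W: some isomorphism of E' onto the preimage in E of u(W') is the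
   identity on A and induces u on the quotients. *)
Definition is_restriction (A E W E' W' : groupType)
    (u : {multiplicative W' -> W})
    (i : {multiplicative A -> E}) (p : {multiplicative E -> W})
    (i' : {multiplicative A -> E'}) (p' : {multiplicative E' -> W'}) :=
  exists phi : {multiplicative E' -> E},
    [/\ injective phi,
        forall x, (exists y, phi y = x) <-> (exists w, p x = u w),
        forall a, phi (i' a) = i a
      & forall y, p (phi y) = u (p' y)].

(* (mu_2)^m, with mu_2 = {+1, -1} realised as the unit group of the integers *)
Definition mu2n (m : nat) : groupType := {ffun 'I_m -> units int}.
Definition mu2_val (R : pzRingType) m (a : mu2n m) (i : 'I_m) : R :=
  (uval (a i))%:~R%R.

Local Close Scope group_scope.

Definition GLH (R : realType) (n : nat) : groupType := units 'M[quat R]_n.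

Lemma diag_uinv (K : nzRingType) n (g : units 'M[K]_n) :
  is_diag_mx (uval g) -> is_diag_mx (uinv g).
Proof.
move=> /is_diag_mxP gD; apply/is_diag_mxP => i j ij.
have e k l : uval g k k * uinv g k l = (k == l)%:R :> K.
  have := uvalK g => /matrixP/(_ k l); rewrite !mxE (bigD1 k) //= big1 ?addr0 //.
  by move=> k' k'k; rewrite gD ?mul0r // eq_sym.
have e' k : uinv g k k * uval g k k = 1.
  have := uinvK g => /matrixP/(_ k k); rewrite !mxE eqxx (bigD1 k) //=.
  by rewrite big1 ?addr0 // => k' k'k; rewrite gD ?mulr0.
by rewrite -[LHS]mul1r -(e' i) -mulrA e -val_eqE /= (negbTE ij) mulr0.
Qed.

Lemma is_diag_mxM (K : nzRingType) n (A B : 'M[K]_n) :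
  is_diag_mx A -> is_diag_mx B -> is_diag_mx (A *m B).
Proof.
move=> /is_diag_mxP AD /is_diag_mxP BD; apply/is_diag_mxP => i j ij.
rewrite mxE big1 // => k _; have [<-|ik] := eqVneq i k.
  by rewrite BD ?mulr0.
by rewrite AD ?mul0r.
Qed.

Definition diagH (R : realType) (n : nat) : subgroup (GLH R n).
Proof.
exists [set g | is_diag_mx (uval g)] => /=.
- exact: scalar_mx_is_diag.
- by move=> x y; exact: is_diag_mxM.
- by move=> x; exact: diag_uinv.
Defined.

Definition WGLH (R : realType) (n : nat) : groupType := sgtype (weyl (diagH R n)).

(* The hyperoctahedral group S_m |x (Z/2)^m.  [wperm] and [wsign] stand for the
   transformation (w h)_i = c^(wsign i) (h_(wperm i)) of m-tuples, where c is
   the action of the generator of Z/2; products of permutations are read from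
   left to right in the library, so that this is a left action. *)
Record WC (m : nat) := WCPair { wperm : 'S_m; wsign : {ffun 'I_m -> bool} }.

Section WCGroup.
Variable m : nat.
Implicit Types u v w : WC m.

Let enc w := (wperm w, wsign w).
Let dec (t : 'S_m * {ffun 'I_m -> bool}) := WCPair t.1 t.2.
Let encK : cancel enc dec. Proof. by case. Qed.

HB.instance Definition _ := Choice.copy (WC m) (can_type encK).

Definition WC_one := @WCPair m 1%g [ffun=> false].
Definition WC_mul u v :=
  WCPair (wperm u * wperm v)%g [ffun i => wsign u i (+) wsign v (wperm u i)].
Definition WC_inv u :=
  WCPair (wperm u)^-1%g [ffun i => wsign u ((wperm u)^-1%g i)].

Fact WC_mulA : associative WC_mul.
Proof.
move=> u v w; congr WCPair; first exact: mulgA.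
by apply/ffunP => i; rewrite !ffunE permM addbA.
Qed.
Fact WC_mul1 : left_id WC_one WC_mul.
Proof.
case=> s e; congr WCPair; first exact: mul1g.
by apply/ffunP => i; rewrite !ffunE perm1.
Qed.
Fact WC_mulr1 : right_id WC_one WC_mul.
Proof.
case=> s e; congr WCPair; first exact: mulg1.
by apply/ffunP => i; rewrite !ffunE addbF.
Qed.
Fact WC_mulV : left_inverse WC_one WC_inv WC_mul.
Proof.
case=> s e; congr WCPair; first exact: mulVg.
by apply/ffunP => i; rewrite !ffunE addbb.
Qed.
Fact WC_mulrV : right_inverse WC_one WC_inv WC_mul.
Proof.
case=> s e; congr WCPair; first exact: mulgV.
by apply/ffunP => i; rewrite !ffunE permK addbb.
Qed.

HB.instance Definition _ := isGroup.Build (WC m)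
  WC_mulA WC_mul1 WC_mulr1 WC_mulV WC_mulrV.

End WCGroup.

Section Embedding.
Variables (R : realType) (m : nat).
Implicit Types (w : WC m) (A : 'M[quat R]_m).

(* The monomial matrix of a permutation and of factors 1 or j; conjugation by
   it sends diag(h_i) to diag(q_i h_(s i) q_i^-1), with q_i = 1 or j. *)
Definition monoj_mx w : 'M[quat R]_m :=
  \matrix_(i, k) if k == wperm w i then
                   if wsign w i then quatj R else 1 else 0.
Definition monoj_inv w : 'M[quat R]_m :=
  \matrix_(k, i) if k == wperm w i then
                   if wsign w i then - quatj R else 1 else 0.

Lemma quatjN : quatj R * - quatj R = 1.
Proof. by congr Quat; rewrite /=; ring. Qed.
Lemma quatNj : - quatj R * quatj R = 1.
Proof. by congr Quat; rewrite /=; ring. Qed.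

Lemma monoj_mxE w A i k : (monoj_mx w *m A) i k =
  (if wsign w i then quatj R else 1) * A (wperm w i) k.
Proof.
rewrite mxE (bigD1 (wperm w i)) //= mxE eqxx big1 ?addr0 // => k' /negbTE k'i.
by rewrite mxE k'i mul0r.
Qed.

Lemma mul_monoj_inv w A i k : (A *m monoj_inv w) i k =
  A i (wperm w k) * (if wsign w k then - quatj R else 1).
Proof.
rewrite mxE (bigD1 (wperm w k)) //= mxE eqxx big1 ?addr0 // => k' /negbTE k'i.
by rewrite mxE k'i mulr0.
Qed.

Fact monoj_mxK w : monoj_mx w *m monoj_inv w = 1%:M.
Proof.
apply/matrixP => i k; rewrite mul_monoj_inv !mxE (inj_eq perm_inj) eq_sym.
by case: eqP => [->|_]; rewrite ?mul0r //; case: ifP; rewrite ?quatjN ?mulr1.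
Qed.
Fact monoj_invK w : monoj_inv w *m monoj_mx w = 1%:M.
Proof.
apply/matrixP => i k; rewrite mxE (bigD1 ((wperm w)^-1%g i)) //= big1 => [|i'].
  rewrite !mxE permKV eqxx addr0 eq_sym.
  by case: eqP => _; rewrite ?mulr0 //; case: ifP; rewrite ?quatNj ?mulr1.
rewrite !mxE; have [->|_ _] := eqVneq i (wperm w i'); first by rewrite permK eqxx.
by rewrite mul0r.
Qed.

Definition monoj w : GLH R m :=
  @Units 'M[quat R]_m (monoj_mx w) (monoj_inv w) (monoj_mxK w) (monoj_invK w).

Lemma monoj_conjE w (h : GLH R m) i k :
  uval (monoj w * h * (monoj w)^-1)%g i k =
  (if wsign w i then quatj R else 1) * uval h (wperm w i) (wperm w k) *
  (if wsign w k then - quatj R else 1).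
Proof. by rewrite [LHS]mul_monoj_inv monoj_mxE. Qed.

Fact monoj_normalizes w : normalizes (diagH R m) (monoj w).
Proof.
move=> h; split=> /is_diag_mxP hD; apply/is_diag_mxP => i k ik.
  have := hD ((wperm w)^-1%g i) ((wperm w)^-1%g k).
  rewrite monoj_conjE !permKV val_eqE (inj_eq perm_inj) => /(_ ik).
  do 2!case: ifP => _; rewrite ?mulr1 ?mul1r //.
  - move/(congr1 (fun x => - quatj R * x * quatj R)).
    by rewrite mulr0 mul0r !mulrA quatNj mul1r -mulrA quatNj mulr1.
  - by move/(congr1 ( *%R (- quatj R))); rewrite mulr0 mulrA quatNj mul1r.
  - by move/(congr1 ( *%R^~ (quatj R))); rewrite mul0r -mulrA quatNj mulr1.
rewrite monoj_conjE hD ?mulr0 ?mul0r //.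
by rewrite val_eqE (inj_eq perm_inj).
Qed.

Definition WSp_emb w : WGLH R m := weyl_conj (monoj_normalizes w).

(* The automorphism attached to w sends diag(h_i) to the diagonal matrix with
   entries h_(wperm w i), or j h_(wperm w i) j^-1 when wsign w i is the
   generator of Z/2. *)
Lemma WSp_embE w (h : sgtype (diagH R m)) i :
  uval (val (val (WSp_emb w) h)) i i =
  let q := uval (val h) (wperm w i) (wperm w i) in
  if wsign w i then quatj R * q * - quatj R else q.
Proof.
rewrite [LHS]monoj_conjE.
by case: ifP => _; rewrite ?mulr1 ?mul1r.
Qed.

Lemma diagH_eq (x y : sgtype (diagH R m)) :
  (forall i, uval (val x) i i = uval (val y) i i) -> x = y.
Proof.
move=> xy; apply/val_inj/units_eq/matrixP => i k.
have [<-//|ik] := eqVneq i k.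
have /set_mem/is_diag_mxP xD := valP x; have /set_mem/is_diag_mxP yD := valP y.
by rewrite xD ?yD.
Qed.

Fact WSp_emb_morph v w : WSp_emb (v * w)%g = (WSp_emb v * WSp_emb w)%g.
Proof.
apply/val_inj/aut_eq => h; apply: diagH_eq => i; rewrite WSp_embE.
rewrite [RHS](WSp_embE v (val (WSp_emb w) h) i) WSp_embE /= !ffunE !permM.
move: (fun_of_matrix _ _ _) => q.
case: (wsign v i); case: (wsign w _) => //=.
by case: q => a b c d; congr Quat; rewrite /=; ring.
Qed.

HB.instance Definition _ :=
  isMultiplicative.Build (WC m) (WGLH R m) WSp_emb WSp_emb_morph.

End Embedding.

(* Typed as a numClosedFieldType, R[i] has the topology of its norm, hence so
   have the matrices over it. *)
Definition C (R : realType) : numClosedFieldType := R[i].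

Section Tits.
Variables (R : realType) (m : nat).
Local Notation C := (C R).
Local Notation M := 'M[C]_(m + m).

Definition mxexp (A : M) : M :=
  limn (fun n : nat => \sum_(k < n) (k`!%:R : C)^-1 *: A ^+ k).

Definition sympl : M := block_mx 0 1%:M (- 1%:M) 0.

Definition Sp : subgroup (units M).
Proof.
exists [set g : units M | (uval g)^T *m sympl *m uval g = sympl] => /=.
- by rewrite trmx1 mul1mx mulmx1.
- move=> x y xS yS; rewrite trmx_mul !mulmxA -(mulmxA (uval y)^T).
  by rewrite -(mulmxA (uval y)^T) xS yS.
- move=> x xS; rewrite -[in LHS]xS !mulmxA -trmx_mul.
  rewrite -[uval x *m uinv x]/(uval x * uinv x) uvalK trmx1 mul1mx.
  by rewrite -mulmxA -[uval x *m uinv x]/(uval x * uinv x) uvalK mulmx1.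
Defined.

(* Chevalley generators, in the realisation X^T J + J X = 0 of sp_2m, for the
   simple roots eps_1 - eps_2, ... , eps_(m-1) - eps_m, and 2 eps_m for the
   last index. *)
Definition chev_e (i : 'I_m) : M :=
  if insub i.+1 is Some i' then
    block_mx (delta_mx i i') 0 0 (- delta_mx i' i)
  else block_mx 0 (delta_mx i i) 0 0.
Definition chev_f (i : 'I_m) : M := (chev_e i)^T.

Definition tits_gen (i : 'I_m) : M :=
  mxexp (((pi / 2)%:C%C : C) *: (chev_f i - chev_e i)).

Definition Tits : subgroup (sgtype Sp) :=
  generated [set g : sgtype Sp | exists i, uval (val g) = tits_gen i].

Definition WT : groupType := sgtype Tits.

Definition WT_mx (x : WT) : M := uval (val (val x)).

Definition torus_mx (t : 'I_m -> C) : M :=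
  block_mx (diag_mx (\row_i t i)) 0 0 (diag_mx (\row_i (t i)^-1)).

Definition WC_act (w : WC m) (t : 'I_m -> C) (i : 'I_m) : C :=
  if wsign w i then (t (wperm w i))^-1 else t (wperm w i).

(* (mu_2)^m is embedded as the 2-torsion of the torus of the diag(t, t^-1), and
   p x is the element of W(C_m) whose action on this torus is conjugation
   by x. *)
Definition is_tits_extension
    (i : {multiplicative mu2n m -> WT}) (p : {multiplicative WT -> WC m}) :=
  [/\ is_extension i p,
      forall a, WT_mx (i a) = torus_mx (mu2_val C a)
    & forall x t, (forall k, t k != 0) ->
        WT_mx x *m torus_mx t = torus_mx (WC_act (p x) t) *m WT_mx x].

End Tits.

(* Main.v *)
Require Import Defs.
From HB Require Import structures.
From mathcomp Require Import all_boot all_order all_algebra all_fingroup.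
From mathcomp Require Import complex ring lra zify.
From mathcomp Require Import all_classical all_reals all_analysis.
Set Implicit Arguments.
Unset Strict Implicit.
Unset Printing Implicit Defensive.
Import Order.TTheory GRing.Theory Num.Theory.
Import numFieldNormedType.Exports.
Local Open Scope classical_set_scope.
Local Open Scope ring_scope.

(* The extension is the group of unitary elements of the normalizer of the
   diagonal subgroup.  A matrix normalizing the diagonal subgroup is monomial
   (conjugate the diagonal matrices with a single entry -1), so multiplying it
   on the left by a real diagonal matrix makes it unitary without changing its
   action; a unitary matrix acting trivially is diagonal with entries central
   of norm 1, that is, +1 or -1.

   The preimage of W(C_m) consists of the monomial matrices with entries +-1
   and +-j.  The entries lie in R + R j, and A + B j |-> [[A, B], [-B, A]] maps
   these matrices into Sp_2m(C).  Since X = f_i - e_i satisfies X^3 = -X, one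
   has exp(pi/2 X) = 1 + X + X^2, which is the image of a monomial matrix above
   the i-th simple reflection.  Hence the Tits group lies in the image of the
   preimage of W(C_m); it is all of it, since it surjects onto W(C_m) and
   contains the diagonal sign matrices as squares of elements above the sign
   changes. *)

(** * Exponentials of matrices with X^3 = -X *)

Lemma cvg_real_complex (R : realType) (u : nat -> R) (l : R) :
  u @ \oo --> l -> (fun n => (u n)%:C%C : C R) @ \oo --> (l%:C%C : C R).
Proof.
move=> /cvgrPdist_lt ul; apply/cvgrPdist_lt => e e0.
(* In the order of the complex numbers a positive element is real, so the complex epsilon is a real
   one. *)
have [e1 e2] : 0 < complex.Re e /\ e = (complex.Re e)%:C%C.
  by move: e0; case: e => a b; rewrite ltcE /= => /andP[/eqP-> ->].
have := ul _ e1; apply: filterS => n lu.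
rewrite e2 -rmorphB /= normc_def /= expr0n /= addr0 sqrtr_sqr.
by rewrite ltcR.
Qed.

Lemma expr_cubeN (A : comPzRingType) n (X : 'M[A]_n) k : X ^+ 3 = - X ->
  X ^+ k.+1 = (-1) ^+ k./2 *: (if odd k then X ^+ 2 else X).
Proof.
move=> X3; elim: k => [|k IH]; first by rewrite /= scale1r.
rewrite exprSr IH -[LHS]/(_ *m _) -scalemxAl -[_ *m X]/(_ * X) /=.
case: (boolP (odd k)) => ok /=.
  by rewrite -exprSr X3 uphalf_half ok add1n exprS scalerN mulN1r scaleNr.
by rewrite -expr2 uphalf_half (negbTE ok).
Qed.

Lemma expr_scalemx (A : comPzRingType) n (a : A) (X : 'M[A]_n) k :
  (a *: X) ^+ k = a ^+ k *: X ^+ k.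
Proof.
elim: k => [|k IH]; first by rewrite !expr0 scale1r.
rewrite !exprS IH -[LHS]/(_ *m _) -scalemxAl -scalemxAr scalerA.
by [].
Qed.

(** This form and that of [cos_coeffS] share one quotient and use the parity split of [expr_cubeN],
    so that [mxexp_cubeN] can abstract the quotient as a single scalar. *)
Lemma sin_coeffS (R : realType) (t : R) n :
  sin_coeff t n.+1 =
    if odd n then 0 else (-1) ^+ n./2 * t ^+ n.+1 / n.+1`!%:R.
Proof.
rewrite -[LHS]/((~~ odd n)%:R * (-1) ^+ n./2 * t ^+ n.+1 / n.+1`!%:R).
by case: (odd n); rewrite ?mul0r ?mul1r.
Qed.

Lemma cos_coeffS (R : realType) (t : R) n :
  cos_coeff t n.+1 =
    if odd n then - ((-1) ^+ n./2 * t ^+ n.+1 / n.+1`!%:R) else 0.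
Proof.
rewrite -[LHS]/((~~ ~~ odd n)%:R * (-1) ^ (uphalf n) * t ^+ n.+1 / n.+1`!%:R).
rewrite negbK uphalf_half -exprnP.
by case: (odd n); rewrite ?mul0r // mul1r add1n exprS mulN1r !mulNr.
Qed.

(** The odd powers collect into the sine series times X. The even positive powers collect into minus
    the cosine series without its constant term, times X^2, whence the factor 1 - cos t. *)
Lemma mxexp_cubeN (R : realType) (m : nat) (X : 'M[C R]_(m + m)) (t : R) :
  X ^+ 3 = - X ->
  mxexp ((t%:C%C : C R) *: X) =
  1 + ((sin t)%:C%C : C R) *: X + ((1 - cos t)%:C%C : C R) *: X ^+ 2.
Proof.
move=> X3.
(* The closed form of the partial sums starts at one term: for the empty sum the right-hand side
   would be 1 + X^2. The limit is therefore taken along the shifted sequence. *)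
have step n : \sum_(k < n.+1) (k`!%:R : C R)^-1 *: ((t%:C%C : C R) *: X) ^+ k =
    1 + ((series (sin_coeff t) n.+1)%:C%C : C R) *: X
      + ((1 - series (cos_coeff t) n.+1)%:C%C : C R) *: X ^+ 2.
  elim: n => [|n IH].
    rewrite big_ord1 /series /= !big_nat1 /sin_coeff /cos_coeff /= !expr0.
    by rewrite invr1 scale1r !mul0r !mul1r invr1 subrr !scale0r !addr0.
  rewrite big_ord_recr [in LHS]/= {}IH.
  have -> : ((nat_of_ord (@ord_max n.+1))`!%:R : C R)^-1 *:
      ((t%:C%C : C R) *: X) ^+ n.+1 =
      (((-1) ^+ n./2 * t ^+ n.+1 / n.+1`!%:R : R)%:C%C : C R) *:
      (if odd n then X ^+ 2 else X).
    rewrite expr_scalemx expr_cubeN // !scalerA; congr (_ *: _).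
    rewrite !rmorphM fmorphV !rmorphXn rmorphN1 rmorph_nat.
    by rewrite mulrC [_^-1 * _]mulrC mulrA.
  rewrite [series (sin_coeff t) n.+2]seriesSr [series (cos_coeff t) n.+2]seriesSr.
  rewrite sin_coeffS cos_coeffS; move: (_ / _) => c.
  case: (odd n); rewrite ?addr0 ?opprD ?opprK ?addrA [in RHS]rmorphD scalerDl;
    rewrite ?addrA //.
  exact: addrAC.
apply: cvg_lim; first exact: norm_hausdorff.
rewrite -(cvg_shiftS _) (funext step).
have cs : series (sin_coeff t) n.+1 @[n --> \oo] --> sin t.
  by rewrite (cvg_shiftS (series _)) unlock; exact: is_cvg_series_sin_coeff.
have cc : series (cos_coeff t) n.+1 @[n --> \oo] --> cos t.
  by rewrite (cvg_shiftS (series _)) unlock; exact: is_cvg_series_cos_coeff.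
apply: cvgD; first apply: cvgD; first exact: cvg_cst.
  by apply: cvgZr_tmp; exact: cvg_real_complex.
apply: cvgZr_tmp; apply: cvg_real_complex; apply: cvgB => //; exact: cvg_cst.
Qed.

(** * Quaternions, signs and normalizers *)

Section Quaternions.
Variable R : realType.
Implicit Types (x y : quat R) (r : R).

Definition qconj x : quat R := Quat (qre x) (- qi x) (- qj x) (- qk x).
Definition qreal r : quat R := Quat r 0 0 0.
(** The reduced norm, that is, the square of the Euclidean norm. *)
Definition qnorm x : R := qre x ^+ 2 + qi x ^+ 2 + qj x ^+ 2 + qk x ^+ 2.

Lemma qreD x y : qre (x + y) = qre x + qre y. Proof. by []. Qed.
Lemma qjD x y : qj (x + y) = qj x + qj y. Proof. by []. Qed.

Lemma qre_sum I (r : seq I) (P : pred I) (F : I -> quat R) :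
  qre (\sum_(i <- r | P i) F i) = \sum_(i <- r | P i) qre (F i).
Proof. exact: (big_morph (@qre R) qreD). Qed.

Lemma qj_sum I (r : seq I) (P : pred I) (F : I -> quat R) :
  qj (\sum_(i <- r | P i) F i) = \sum_(i <- r | P i) qj (F i).
Proof. exact: (big_morph (@qj R) qjD). Qed.

Lemma qconjD x y : qconj (x + y) = qconj x + qconj y.
Proof. by case: x y => ????[]????; congr Quat; rewrite /= opprD. Qed.

Lemma qconj0 : qconj 0 = 0.
Proof. by congr Quat; rewrite /= ?oppr0. Qed.

Lemma qconj1 : qconj 1 = 1.
Proof. by congr Quat; rewrite /= ?oppr0. Qed.

Lemma qconjK : involutive qconj.
Proof. by case=> *; congr Quat; rewrite /= ?opprK. Qed.

Lemma qconjM x y : qconj (x * y) = qconj y * qconj x.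
Proof. by case: x y => ????[]????; congr Quat => /=; ring. Qed.

Lemma qconj_sum I (r : seq I) (P : pred I) (F : I -> quat R) :
  qconj (\sum_(i <- r | P i) F i) = \sum_(i <- r | P i) qconj (F i).
Proof. exact: (big_morph qconj qconjD qconj0). Qed.

Lemma qrealD r s : qreal (r + s) = qreal r + qreal s.
Proof. by congr Quat; rewrite /= ?addr0. Qed.

Lemma qrealM r s : qreal (r * s) = qreal r * qreal s.
Proof. by congr Quat => /=; ring. Qed.

Lemma qreal_sum I (r : seq I) (P : pred I) (F : I -> R) :
  \sum_(i <- r | P i) qreal (F i) = qreal (\sum_(i <- r | P i) F i).
Proof. exact/esym/(big_morph qreal qrealD). Qed.

Lemma qrealC r x : qreal r * x = x * qreal r.
Proof. by case: x => ????; congr Quat => /=; ring. Qed.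

Lemma qmul_conj x : x * qconj x = qreal (qnorm x).
Proof. by case: x => ????; congr Quat; rewrite /qnorm /=; ring. Qed.

Lemma qconj_mul x : qconj x * x = qreal (qnorm x).
Proof. by case: x => ????; congr Quat; rewrite /qnorm /=; ring. Qed.

Lemma qnorm_ge0 x : 0 <= qnorm x.
Proof. by rewrite !addr_ge0 ?sqr_ge0. Qed.

Lemma qnorm_eq0 x : (qnorm x == 0) = (x == 0).
Proof.
apply/idP/eqP => [|->]; last by rewrite /qnorm /= expr0n /= !addr0.
rewrite /qnorm !paddr_eq0 ?addr_ge0 ?sqr_ge0 // !sqrf_eq0.
by case: x => a b c d /= /andP[/andP[/andP[/eqP-> /eqP->] /eqP->] /eqP->].
Qed.

Lemma qmulV x : x != 0 -> {y | x * y = 1 & y * x = 1}.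
Proof.
rewrite -qnorm_eq0 => x0; exists (qconj x * qreal (qnorm x)^-1).
  by rewrite mulrA qmul_conj -qrealM divff.
by rewrite -mulrA qrealC mulrA qconj_mul -qrealM divff.
Qed.

Lemma qmulfI x y z : z != 0 -> z * x = z * y -> x = y.
Proof. by case/qmulV => t _ tz /(congr1 ( *%R t)); rewrite !mulrA tz !mul1r. Qed.

Lemma qopp_eq0 x : x = - x -> x = 0.
Proof.
case: x => a b c d [] e1 e2 e3 e4.
have z (u : R) : u = - u -> u = 0.
  by move/eqP; rewrite -addr_eq0 -mulr2n mulrn_eq0 => /eqP.
by congr Quat; exact: z.
Qed.

Lemma q1_neqN1 : (1 : quat R) <> -1.
Proof. by move/qopp_eq0/eqP; rewrite oner_eq0. Qed.

End Quaternions.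

Lemma units_intP (a : units int) : uval a = 1 \/ uval a = -1.
Proof.
have /intUnitRing.unitzPl : uinv a * uval a = 1 by exact: uinvK.
by case/orP => /eqP; [left | right].
Qed.

Lemma mu2_valP (R : pzRingType) m (a : mu2n m) i :
  mu2_val R a i = 1 \/ mu2_val R a i = -1.
Proof.
rewrite /mu2_val; case: (units_intP (a i)) => ->; first by left.
by right; rewrite rmorphN1.
Qed.

Lemma mu2_valM (R : pzRingType) m (a b : mu2n m) i :
  mu2_val R (a * b)%g i = mu2_val R a i * mu2_val R b i.
Proof. by rewrite /mu2_val ffunE rmorphM. Qed.

Lemma mu2_val_sqr (R : pzRingType) m (a : mu2n m) i :
  mu2_val R a i * mu2_val R a i = 1.
Proof. by case: (mu2_valP R a i) => ->; rewrite ?mulrNN mulr1. Qed.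

Lemma mu2_valC (R : pzRingType) m (a : mu2n m) i (x : R) :
  mu2_val R a i * x = x * mu2_val R a i.
Proof. by case: (mu2_valP R a i) => ->; rewrite ?mulN1r ?mulrN1 ?mul1r ?mulr1. Qed.

Definition sgn_unit (b : bool) : units int :=
  if b then @Units int (-1) (-1) erefl erefl else 1%g.

Lemma mu2_val_sgn (R : pzRingType) m (f : 'I_m -> bool) i :
  mu2_val R [ffun k => sgn_unit (f k)] i = if f i then -1 else 1.
Proof. by rewrite /mu2_val ffunE; case: (f i); rewrite /= ?rmorphN1. Qed.

Section Normalizer.
Variables (G : groupType) (T : subgroup G).
Local Open Scope group_scope.

Lemma normalizes1 : normalizes T 1.
Proof. by move=> h; rewrite invg1 mul1g mulg1. Qed.

Lemma normalizesM g g' : normalizes T g -> normalizes T g' -> normalizes T (g * g').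
Proof.
by move=> gN gN' h; rewrite -(gN' h) -(gN (g' * h * g'^-1)) invgM !mulgA.
Qed.

Lemma normalizesV g : normalizes T g -> normalizes T g^-1.
Proof.
by move=> gN h; rewrite -[X in X <-> _]gN invgK !mulgA mulgV mul1g mulgK.
Qed.

Lemma normalizes_sub g : sg_set T g -> normalizes T g.
Proof.
move=> Tg h; split=> Th; last by apply/sg_mul/sg_inv/Tg/sg_mul.
have -> : h = g^-1 * (g * h * g^-1) * g by rewrite !mulgA mulVg mul1g mulgKV.
by apply: sg_mul => //; apply: sg_mul => //; exact: sg_inv.
Qed.

Lemma weyl_conjM g g' (gN : normalizes T g) (gN' : normalizes T g')
    (gN2 : normalizes T (g * g')) :
  weyl_conj gN2 = weyl_conj gN * weyl_conj gN'.
Proof. by apply/val_inj/aut_eq => h; apply: val_inj; rewrite /= invgM !mulgA. Qed.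

(** Turns equalities in the Weyl group into equations between elements of G, and back. *)
Lemma weyl_conj_eq g g' (gN : normalizes T g) (gN' : normalizes T g') :
  weyl_conj gN = weyl_conj gN' <->
  forall h, sg_set T h -> g * h * g^-1 = g' * h * g'^-1.
Proof.
split=> [e h Th|e]; last first.
  by apply/val_inj/aut_eq => h; apply/val_inj/e/set_mem/valP.
have := congr1 (fun f : sgtype (weyl T) => val (val f (exist _ h (mem_set Th)))) e.
by [].
Qed.

End Normalizer.

Lemma multiplicative1 (G H : groupType) (f : {multiplicative G -> H}) : f 1%g = 1%g.
Proof. by apply: (@mulgI _ (f 1%g)); rewrite -gmulfM !mulg1. Qed.

Lemma multiplicativeV (G H : groupType) (f : {multiplicative G -> H}) x :
  f x^-1%g = (f x)^-1%g.
Proof. by apply: (@mulgI _ (f x)); rewrite -gmulfM !mulgV multiplicative1. Qed.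

(** * Unitary normalizer of the diagonal subgroup *)

Section UnitaryNormalizer.
Variables (R : realType) (n : nat).
Local Notation M := 'M[quat R]_n.
Implicit Types (A B : M) (g : GLH R n).

Definition ctr A : M := \matrix_(i, k) qconj (A k i).

Lemma ctrM A B : ctr (A *m B) = ctr B *m ctr A.
Proof.
apply/matrixP => i k; rewrite !mxE qconj_sum; apply: eq_bigr => l _.
by rewrite !mxE qconjM.
Qed.

Lemma ctr1 : ctr 1%:M = 1%:M.
Proof.
apply/matrixP => i k; rewrite !mxE eq_sym.
by case: eqP => _; rewrite ?qconj0 ?qconj1.
Qed.

Lemma ctrK : involutive ctr.
Proof. by move=> A; apply/matrixP => i k; rewrite !mxE qconjK. Qed.

Definition unitary g := uinv g = ctr (uval g).

(** Since g is already invertible, a right inverse is the inverse. *)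
Lemma unitaryP g : uval g *m ctr (uval g) = 1%:M -> unitary g.
Proof.
move=> gg; rewrite /unitary -[LHS]mulmx1 -gg mulmxA.
by rewrite -[uinv g *m uval g]/(uinv g * uval g) uinvK mul1mx.
Qed.

(** The intersection of the normalizer with the compact symplectic group, the unitary group of the
    standard quaternionic Hermitian form. *)
Definition unormal : subgroup (GLH R n).
Proof.
exists [set g | normalizes (diagH R n) g /\ unitary g].
- by split; [exact: normalizes1 | exact/esym/ctr1].
- move=> x y [xN xU] [yN yU]; split; first exact: normalizesM.
  by rewrite /unitary ctrM -xU -yU.
- move=> x [xN xU]; split; first exact: normalizesV.
  by rewrite /unitary /= xU ctrK.
Defined.

Definition Wtilde : groupType := sgtype unormal.
Implicit Types x y : Wtilde.

Lemma Wtilde_normalizes x : normalizes (diagH R n) (val x).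
Proof. by have /set_mem[] := valP x. Qed.

Lemma Wtilde_unitary x : unitary (val x).
Proof. by have /set_mem[] := valP x. Qed.

Definition Wproj x : WGLH R n := weyl_conj (@Wtilde_normalizes x).

Fact Wproj_morph : {morph Wproj : x y / (x * y)%g}.
Proof. by move=> x y; exact: weyl_conjM. Qed.
HB.instance Definition _ :=
  isMultiplicative.Build Wtilde (WGLH R n) Wproj Wproj_morph.

Lemma Wproj1 : Wproj 1%g = 1%g.
Proof. exact: (multiplicative1 Wproj). Qed.

Lemma WprojV x : Wproj x^-1%g = (Wproj x)^-1%g.
Proof. exact: (multiplicativeV Wproj). Qed.

Definition diag_sgn (a : mu2n n) : M := diag_mx (\row_i mu2_val (quat R) a i).

Lemma diag_sgnM (a b : mu2n n) : diag_sgn (a * b)%g = diag_sgn a *m diag_sgn b.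
Proof.
rewrite /diag_sgn mulmx_diag; congr diag_mx.
by apply/rowP => i; rewrite !mxE mu2_valM.
Qed.

Lemma diag_sgn_sqr a : diag_sgn a *m diag_sgn a = 1%:M.
Proof.
rewrite /diag_sgn mulmx_diag; apply/matrixP => i k; rewrite !mxE.
by rewrite mu2_val_sqr; case: eqP.
Qed.

Lemma ctr_diag_sgn a : ctr (diag_sgn a) = diag_sgn a.
Proof.
apply/matrixP => i k; rewrite !mxE eq_sym; have [->|_] := eqVneq.
  by rewrite !mulr1n; case: (mu2_valP (quat R) a k) => ->; congr Quat; rewrite /= ?oppr0.
by rewrite !mulr0n qconj0.
Qed.

Definition diagu (a : mu2n n) : GLH R n :=
  @Units M (diag_sgn a) (diag_sgn a) (diag_sgn_sqr a) (diag_sgn_sqr a).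

Lemma diagu_diagH a : sg_set (diagH R n) (diagu a).
Proof. exact: diag_mx_is_diag. Qed.

Fact diagu_unormal a : diagu a \in sg_set unormal.
Proof.
apply/mem_set; split; last by rewrite /unitary /= ctr_diag_sgn.
exact/normalizes_sub/diagu_diagH.
Qed.

Definition signs (a : mu2n n) : Wtilde :=
  exist (fun g => g \in sg_set unormal) (diagu a) (diagu_unormal a).

Fact signs_morph : {morph signs : a b / (a * b)%g}.
Proof. by move=> a b; apply/val_inj/units_eq/diag_sgnM. Qed.
HB.instance Definition _ := isMultiplicative.Build (mu2n n) Wtilde signs signs_morph.

Lemma signs_mulE a x i k :
  uval (val (signs a * x)%g) i k = mu2_val (quat R) a i * uval (val x) i k.
Proof. by rewrite [LHS](_ : _ = (diag_sgn a *m uval (val x)) i k) // mul_diag_mx !mxE. Qed.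

Lemma signs_inj : injective signs.
Proof.
move=> a b /(congr1 (fun x : Wtilde => uval (val x))) /= /matrixP e.
apply/ffunP => i; apply: units_eq; have := e i i.
rewrite !mxE eqxx !mulr1n /mu2_val.
case: (units_intP (a i)) => ->; case: (units_intP (b i)) => -> //.
  by rewrite rmorphN1 => /q1_neqN1.
by rewrite rmorphN1 => /esym/q1_neqN1.
Qed.

(** The diagonal matrices with a single entry -1 serve as test elements: they detect the vanishing
    of entries both of normalizing and of centralizing matrices. *)
Definition flip (l : 'I_n) : mu2n n := [ffun k => sgn_unit (k == l)].

Lemma mu2_val_flip (A : pzRingType) l i : mu2_val A (flip l) i = if i == l then -1 else 1.
Proof. exact: mu2_val_sgn. Qed.

(** The conjugate D of the test matrix of [flip l] by the inverse of g is diagonal. In g D =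
    [diag_sgn (flip l)] g, a nonzero entry of column i in row l forces D i i = -1, and one in a row
    k other than l forces D i i = 1. *)
Lemma normalizes_col g i k l : normalizes (diagH R n) g ->
  uval g k i != 0 -> uval g l i != 0 -> k = l.
Proof.
move=> gN gk gl; apply/eqP/contraT => kl.
pose D := uval (g^-1 * diagu (flip l) * g)%g.
have Dd : is_diag_mx D.
  have := (normalizesV gN (diagu (flip l))).2 (diagu_diagH _).
  by rewrite invgK.
have e : uval g *m D = diag_sgn (flip l) *m uval g.
  by rewrite -[LHS]/(uval (g * (g^-1 * diagu (flip l) * g))%g) !mulgA mulgV mul1g.
have E j : uval g j i * D i i = mu2_val (quat R) (flip l) j * uval g j i.
  clearbody D; have /is_diag_mxP Dd' := Dd.
  move/matrixP/(_ j i): e; rewrite mul_diag_mx !mxE => <-.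
  by rewrite (bigD1 i) //= big1 ?addr0 // => m mi; rewrite Dd' ?mulr0.
have := E k; have := E l; rewrite !mu2_val_flip (negbTE kl) eqxx mulN1r mul1r.
have d1 : uval g k i = uval g k i * 1 by rewrite mulr1.
have d2 : - uval g l i = uval g l i * -1 by rewrite mulrN1.
by rewrite d2 {2}d1 => /(qmulfI gl) -> /(qmulfI gk)/esym/q1_neqN1.
Qed.

(** By [normalizes_col] distinct rows of g have disjoint supports, so g times [ctr g] is diagonal,
    with the sums N i of the squared norms along the rows as entries. Dividing row i by the square
    root of N i makes g unitary. *)
Lemma rescale_unitary g : normalizes (diagH R n) g ->
  exists r : 'I_n -> R, (forall i, r i != 0) /\
   let D := diag_mx (\row_i qreal (r i)) in
   (D *m uval g) *m ctr (D *m uval g) = 1%:M.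
Proof.
move=> gN; pose N i := \sum_k qnorm (uval g i k).
(* A zero row would contradict the invertibility of g. *)
have N_gt0 i : 0 < N i.
  rewrite lt0r sumr_ge0 ?andbT => [|k _]; last exact: qnorm_ge0.
  apply/negP; rewrite psumr_eq0 => [/allP g0|k _]; last exact: qnorm_ge0.
  have /matrixP/(_ i i) := uvalK g; rewrite !mxE eqxx big1 => [/eqP|k _].
    by rewrite eq_sym oner_eq0.
  have /eqP := g0 k (mem_index_enum k); move/eqP; rewrite qnorm_eq0 => /eqP ->.
  by rewrite mul0r.
have r0 i : (Num.sqrt (N i))^-1 != 0 by rewrite invr_eq0 sqrtr_eq0 -ltNge.
exists (fun i => (Num.sqrt (N i))^-1); split=> //=.
have gg i k : (uval g *m ctr (uval g)) i k = if i == k then qreal (N i) else 0.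
  rewrite mxE; have [<-|ik] := eqVneq i k.
    by rewrite -qreal_sum; apply: eq_bigr => l _; rewrite mxE qmul_conj.
  apply: big1 => l _; rewrite mxE.
  have [->|gi] := eqVneq (uval g i l) 0; first by rewrite mul0r.
  have [->|gk] := eqVneq (uval g k l) 0; first by rewrite qconj0 mulr0.
  by move: ik; rewrite (normalizes_col gN gi gk) eqxx.
rewrite ctrM mulmxA -(mulmxA (diag_mx _)); apply/matrixP => i k.
have -> : ctr (diag_mx (\row_i0 qreal (Num.sqrt (N i0))^-1)) =
    diag_mx (\row_i0 qreal (Num.sqrt (N i0))^-1).
  apply/matrixP => a b; rewrite !mxE eq_sym; have [->|_] := eqVneq.
    by rewrite !mulr1n; congr Quat; rewrite /= oppr0.
  by rewrite !mulr0n qconj0.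
rewrite mul_mx_diag mul_diag_mx; move: (uval g *m _) gg => G gg.
rewrite !mxE gg; have [<-|_] := eqVneq; last by rewrite mulr0 mul0r.
rewrite -!qrealM mulrAC -invfM -expr2 sqr_sqrtr ?ltW // mulVf //.
by rewrite gt_eqF.
Qed.

Lemma Wproj_surj (w : WGLH R n) : exists x, Wproj x = w.
Proof.
have [g gN gw] := set_mem (valP w).
have [r [r0 rU]] := rescale_unitary gN.
have rr (s t : 'I_n -> R) : (forall i, s i * t i = 1) ->
    diag_mx (\row_i qreal (s i)) *m diag_mx (\row_i qreal (t i)) = 1%:M.
  move=> st; rewrite mulmx_diag; apply/matrixP => i k; rewrite !mxE.
  by rewrite -qrealM st; case: eqP.
pose d : GLH R n := @Units M (diag_mx (\row_i qreal (r i)))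
  (diag_mx (\row_i qreal (r i)^-1)) (rr _ _ (fun i => divff (r0 i)))
  (rr _ _ (fun i => mulVf (r0 i))).
have dN : normalizes (diagH R n) d by apply/normalizes_sub/diag_mx_is_diag.
have dgN : (d * g)%g \in sg_set unormal.
  by apply/mem_set; split; [exact: normalizesM | exact: unitaryP].
exists (exist (fun g => g \in sg_set unormal) _ dgN).
apply/val_inj/aut_eq => h; apply: val_inj; rewrite gw.
have : sg_set (diagH R n) (g * val h * g^-1)%g by apply/gN/set_mem/valP.
rewrite -[LHS]/((d * g) * val h * (d * g)^-1)%g invgM.
(* The inner conjugate is again diagonal and d has real, hence central, entries: the two commute,
   and d disappears from the action. *)
have -> : (d * g * val h * (g^-1 * d^-1) = d * (g * val h * g^-1) * d^-1)%g.
  by rewrite !mulgA.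
move: (g * _ * _)%g => k kD.
apply/(canLR (mulgK _))/units_eq; rewrite -[LHS]/(_ *m _) -[RHS]/(_ *m _) /=.
move: kD => /= /is_diag_mxP kD; apply/matrixP => i l.
rewrite mul_mx_diag mul_diag_mx !mxE qrealC.
by have [->//|il] := eqVneq i l; rewrite kD ?mul0r.
Qed.

Lemma Wproj_eq1 x : Wproj x = 1%g <-> exists a, signs a = x.
Proof.
split=> [e|[a <-]]; last first.
  have : Wproj (signs a) = Wproj 1%g; last by rewrite Wproj1.
  apply/weyl_conj_eq => h; rewrite mul1g invg1 mulg1 /= => /is_diag_mxP hD.
  apply/(canLR (mulgK _))/units_eq; rewrite -[LHS]/(_ *m _) -[RHS]/(_ *m _) /=.
  apply/matrixP => i l; rewrite mul_mx_diag mul_diag_mx !mxE mu2_valC.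
  by have [->//|il] := eqVneq i l; rewrite hD ?mul0r.
have {e} xC (h : GLH R n) : sg_set (diagH R n) h ->
    uval (val x) *m uval h = uval h *m uval (val x).
  move=> hD; have : Wproj x = Wproj 1%g by rewrite e Wproj1.
  move/weyl_conj_eq/(_ h hD); rewrite mul1g invg1 mulg1.
  by move/(canRL (mulgVK _))/(congr1 (@uval _)).
(* Commutation with the test matrix of [flip i] equates the entry (i, k) with its opposite. *)
have xD i k : i != k -> uval (val x) i k = 0.
  move=> ik; have /matrixP/(_ i k) := xC _ (diagu_diagH (flip i)).
  rewrite mul_mx_diag mul_diag_mx !mxE !mu2_val_flip eqxx eq_sym (negbTE ik).
  by rewrite mulr1 mulN1r => /qopp_eq0.
(* Commuting with the scalar matrix of the unit i kills the j and k components, and commuting with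
   that of j kills the i component. The real number left has square 1 by unitarity. *)
have xS i : uval (val x) i i = 1 \/ uval (val x) i i = -1.
  pose qi : quat R := Quat 0 1 0 0; pose qj := quatj R.
  have central q (qq : q * - q = 1) : uval (val x) i i * q = q * uval (val x) i i.
    have qq' : - q * q = 1 by rewrite mulNr -mulrN.
    have sm a b : a * b = 1 -> a%:M *m b%:M = 1%:M :> M.
      by move=> ab; rewrite -scalar_mxM ab.
    pose h : GLH R n := @Units M q%:M (- q)%:M (sm _ _ qq) (sm _ _ qq').
    have hD : sg_set (diagH R n) h by exact: scalar_mx_is_diag.
    by have /matrixP/(_ i i) := xC h hD;
      rewrite -[uval h]/(q%:M) -diag_const_mx mul_mx_diag mul_diag_mx !mxE.
  have ci : uval (val x) i i * qi = qi * uval (val x) i i.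
    by apply: central; congr Quat; rewrite /=; ring.
  have cj : uval (val x) i i * qj = qj * uval (val x) i i.
    by apply: central; congr Quat; rewrite /=; ring.
  have n1 : qnorm (uval (val x) i i) = 1.
    have /matrixP/(_ i i) := uvalK (val x).
    rewrite Wtilde_unitary !mxE (bigD1 i) //= big1 ?addr0 => [|k ki].
      by rewrite mxE qmul_conj eqxx => -[].
    by rewrite xD ?mul0r // eq_sym.
  have z (u : R) : u = - u -> u = 0.
    by move/eqP; rewrite -addr_eq0 -mulr2n mulrn_eq0 => /eqP.
  move: ci cj n1; case: (uval (val x) i i) => a b c d; rewrite /qi /qj.
  case=> _ _ e1 e2; case=> _ _ _ e3.
  have d0 : d = 0 by lra.
  have c0 : c = 0 by lra.
  have b0 : b = 0 by lra.
  rewrite b0 c0 d0 /qnorm /= expr0n /= !addr0 => /eqP.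
  rewrite sqrf_eq1 => /orP[]/eqP->; [by left | right].
  by congr Quat; rewrite /= oppr0.
have xE i : exists s : units int, uval (val x) i i = (uval s)%:~R.
  by case: (xS i) => ->; [exists 1%g | exists (sgn_unit true); rewrite /= rmorphN1].
have [s sE] := choice xE.
exists [ffun i => s i]; apply/val_inj/units_eq/matrixP => i k.
rewrite !mxE /mu2_val ffunE -sE; have [<-|ik] := eqVneq; first by rewrite mulr1n.
by rewrite mulr0n xD.
Qed.

End UnitaryNormalizer.

(** * Complex form of matrices over R + R j *)

Section ComplexForm.
Variables (R : realType) (m : nat).
Local Notation M := 'M[quat R]_m.
Local Notation "x %:CC" := (x%:C%C : C R) (at level 2, format "x %:CC").
Implicit Types (X Y : M) (w : WC m) (x : Wtilde R m) (y : sgtype (Sp R m)).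

Definition re_mx X : 'M[C R]_m := map_mx (fun q => (qre q)%:CC) X.
Definition j_mx X : 'M[C R]_m := map_mx (fun q => (qj q)%:CC) X.

(* On matrices with entries in R + R j this is the complex form A + B j |->
   [[A, B], [-B, A]] of a quaternionic matrix; elsewhere it is junk. *)
Definition cform X : 'M[C R]_(m + m) :=
  block_mx (re_mx X) (j_mx X) (- j_mx X) (re_mx X).

(** R + R j is a commutative subfield on which the usual form [[A, B], [-conj B, conj A]] has real
    blocks, so that no conjugation appears in [cform]. *)
Definition in_Rj X := forall i k, qi (X i k) = 0 /\ qk (X i k) = 0.

Lemma qi_sum I (r : seq I) (P : pred I) (F : I -> quat R) :
  qi (\sum_(i <- r | P i) F i) = \sum_(i <- r | P i) qi (F i).
Proof. exact: (big_morph (@qi R) (id1 := 0) (op1 := +%R)). Qed.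

Lemma qk_sum I (r : seq I) (P : pred I) (F : I -> quat R) :
  qk (\sum_(i <- r | P i) F i) = \sum_(i <- r | P i) qk (F i).
Proof. exact: (big_morph (@qk R) (id1 := 0) (op1 := +%R)). Qed.

Lemma in_RjM X Y : in_Rj X -> in_Rj Y -> in_Rj (X *m Y).
Proof.
move=> Xj Yj i k; rewrite mxE qi_sum qk_sum; split; apply: big1 => l _;
  case: (X i l) (Xj i l) => a b c d /= [-> ->];
  by case: (Y l k) (Yj l k) => a' b' c' d' /= [-> ->]; ring.
Qed.

Lemma in_Rj_ctr X : in_Rj X -> in_Rj (ctr X).
Proof. by move=> Xj i k; rewrite mxE /=; case: (Xj k i) => -> ->; rewrite oppr0. Qed.

(** The components of Y along i and k enter the real and j parts of a product only multiplied by
    those of X, which vanish. *)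
Lemma re_mxM X Y : in_Rj X ->
  re_mx (X *m Y) = re_mx X *m re_mx Y - j_mx X *m j_mx Y.
Proof.
move=> Xj; apply/matrixP => i k; rewrite !mxE qre_sum rmorph_sum -sumrB.
apply: eq_bigr => l _; rewrite !mxE -!rmorphM -rmorphB; congr (_%:CC).
by case: (X i l) (Xj i l) => a b c d /= [-> ->]; case: (Y l k) => a' b' c' d' /=; ring.
Qed.

Lemma j_mxM X Y : in_Rj X ->
  j_mx (X *m Y) = re_mx X *m j_mx Y + j_mx X *m re_mx Y.
Proof.
move=> Xj; apply/matrixP => i k; rewrite !mxE qj_sum rmorph_sum -big_split /=.
apply: eq_bigr => l _; rewrite !mxE -!rmorphM -rmorphD; congr (_%:CC).
by case: (X i l) (Xj i l) => a b c d /= [-> ->]; case: (Y l k) => a' b' c' d' /=; ring.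
Qed.

Lemma cformM X Y : in_Rj X -> cform (X *m Y) = cform X *m cform Y.
Proof.
move=> Xj; rewrite /cform mulmx_block re_mxM // j_mxM //.
rewrite !(mulmxN, mulNmx).
by congr block_mx; [rewrite opprD addrC | rewrite addrC].
Qed.

Lemma re_mx1 : re_mx 1%:M = 1%:M.
Proof. by apply/matrixP => i k; rewrite !mxE; case: eqP. Qed.

Lemma j_mx1 : j_mx 1%:M = 0.
Proof. by apply/matrixP => i k; rewrite !mxE; case: eqP. Qed.

Lemma cform1 : cform 1%:M = 1%:M.
Proof. by rewrite /cform re_mx1 j_mx1 oppr0 -scalar_mx_block. Qed.

(** Quaternionic conjugation fixes the real part and negates the j part, which is what transposition
    does to the off-diagonal blocks. *)
Lemma cform_ctr X : cform (ctr X) = (cform X)^T.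
Proof.
rewrite /cform tr_block_mx; congr block_mx; apply/matrixP => i k; rewrite !mxE //=.
  by rewrite rmorphN.
by rewrite rmorphN opprK.
Qed.

Lemma cform_inj X Y : in_Rj X -> in_Rj Y -> cform X = cform Y -> X = Y.
Proof.
move=> Xj Yj /eq_block_mx[/matrixP eR /matrixP eJ _ _]; apply/matrixP => i k.
move: (eR i k) (eJ i k) (Xj i k) (Yj i k); rewrite !mxE.
by case: (X i k) (Y i k) => a b c d [a' b' c' d'] [->] [->] /= [-> ->] [-> ->].
Qed.

(** The matrix [sympl] is the complex form of the scalar matrix j, which commutes with X because R +
    R j is commutative. The symplectic condition thus reduces to unitarity. *)
Lemma cform_sympl X : in_Rj X -> ctr X *m X = 1%:M ->
  (cform X)^T *m sympl R m *m cform X = sympl R m.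
Proof.
move=> Xj XX.
have e : sympl R m *m cform X = cform X *m sympl R m.
  rewrite /sympl /cform !mulmx_block !(mul0mx, mulmx0, mulmx1, mul1mx, mulNmx, mulmxN).
  by rewrite !(add0r, addr0).
rewrite -mulmxA e mulmxA -cform_ctr -cformM; last exact: in_Rj_ctr.
by rewrite XX cform1 mul1mx.
Qed.

(** A relation rather than a map, because the complex form is multiplicative only on matrices over R
    + R j. It is compatible with the group laws and single-valued in both directions. *)
Definition corresponds x y :=
  in_Rj (uval (val x)) /\ uval (val y) = cform (uval (val x)).

Lemma corresponds1 : corresponds 1%g 1%g.
Proof.
split; last by rewrite /= cform1.
by move=> i k; rewrite /= mxE; case: eqP.
Qed.

Lemma correspondsM x y x' y' : corresponds x y -> corresponds x' y' ->
  corresponds (x * x')%g (y * y')%g.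
Proof.
move=> [xj yx] [xj' yx']; split; first exact: in_RjM.
rewrite -[LHS]/(uval (val y) *m uval (val y')) yx yx'.
by rewrite -cformM.
Qed.

(** By unitarity the inverse of x is [ctr x], whose entries stay in R + R j. *)
Lemma correspondsV x y : corresponds x y -> corresponds x^-1%g y^-1%g.
Proof.
move=> [xj yx]; have xj' : in_Rj (uval (val x^-1%g)).
  by rewrite -[uval _]/(uinv (val x)) Wtilde_unitary; exact: in_Rj_ctr.
split=> //; rewrite -[LHS]/(uinv (val y)).
have e : cform (uval (val x^-1%g)) *m uval (val y) = 1%:M.
  by rewrite yx -cformM // -[_ *m _]/(uval (val (x^-1 * x)%g)) mulVg cform1.
by rewrite -[LHS]mul1mx -e -mulmxA -[_ *m uinv _]/(_ * _) uvalK mulmx1.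
Qed.

Lemma corresponds_fun x y y' : corresponds x y -> corresponds x y' -> y = y'.
Proof. by move=> [_ e] [_ e']; apply/val_inj/units_eq; rewrite e e'. Qed.

Lemma corresponds_inj x x' y : corresponds x y -> corresponds x' y -> x = x'.
Proof.
by move=> [xj e] [xj' e']; apply/val_inj/units_eq/cform_inj; rewrite // -e.
Qed.

Lemma corresponds_ex x : in_Rj (uval (val x)) -> exists y, corresponds x y.
Proof.
move=> xj; set X := uval (val x).
have XV : X *m ctr X = 1%:M by rewrite -Wtilde_unitary; exact: uvalK.
have VX : ctr X *m X = 1%:M by rewrite -Wtilde_unitary; exact: uinvK.
have e : cform X *m cform (ctr X) = 1%:M by rewrite -cformM // XV cform1.
have e' : cform (ctr X) *m cform X = 1%:M.
  by rewrite -cformM ?VX ?cform1 //; exact: in_Rj_ctr.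
pose g : units 'M[C R]_(m + m) := @Units 'M[C R]_(m + m) _ _ e e'.
have gS : g \in sg_set (Sp R m) by apply/mem_set/cform_sympl.
by exists (exist (fun g => g \in sg_set (Sp R m)) g gS).
Qed.

Fact monoj_unormal w : monoj R w \in sg_set (unormal R m).
Proof.
apply/mem_set; split; first exact: monoj_normalizes.
apply/matrixP => i k; rewrite !mxE; case: eqP => _; last by rewrite qconj0.
by case: ifP => _; congr Quat; rewrite /= ?oppr0.
Qed.

Definition monoj_lift w : Wtilde R m :=
  exist (fun g => g \in sg_set (unormal R m)) (monoj R w) (monoj_unormal w).

Lemma WSp_emb1 : WSp_emb R (1%g : WC m) = 1%g.
Proof. exact: (multiplicative1 (@WSp_emb R m)). Qed.

Lemma WSp_embV w : WSp_emb R w^-1%g = (WSp_emb R w)^-1%g.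
Proof. exact: (multiplicativeV (@WSp_emb R m)). Qed.

Lemma Wproj_lift w : Wproj (monoj_lift w) = WSp_emb R w.
Proof. exact/weyl_conj_eq. Qed.

Lemma Wproj_eq x x' : Wproj x = Wproj x' <-> exists a, x = (signs R a * x')%g.
Proof.
split=> [e|[a ->]]; last first.
  by rewrite Wproj_morph (Wproj_eq1 (signs R a)).2 ?mul1g //; exists a.
have /Wproj_eq1[a ax] : Wproj (x * x'^-1)%g = 1%g.
  by rewrite Wproj_morph WprojV e mulgV.
by exists a; rewrite ax mulgVK.
Qed.

Lemma signs_liftE a w i k : uval (val (signs R a * monoj_lift w)%g) i k =
  if k == wperm w i then mu2_val (quat R) a i * (if wsign w i then quatj R else 1)
  else 0.
Proof. by rewrite signs_mulE mxE; case: eqP => _; rewrite ?mulr0. Qed.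

Lemma signs_lift_Rj a w : in_Rj (uval (val (signs R a * monoj_lift w)%g)).
Proof.
move=> i k; rewrite signs_liftE; case: eqP => // _.
by case: (mu2_valP (quat R) a i) => ->; case: ifP => _; rewrite ?mulN1r ?mul1r /= ?oppr0.
Qed.

(** Two monomial lifts with the same action differ by diagonal signs. The positions of the nonzero
    entries then give the permutation, and the signs cannot turn 1 into j. *)
Lemma WSp_emb_inj : injective (@WSp_emb R m).
Proof.
move=> v w; rewrite -!Wproj_lift => /Wproj_eq[a e].
have E i k : (if k == wperm v i then if wsign v i then quatj R else 1 else 0) =
  if k == wperm w i then mu2_val (quat R) a i * (if wsign w i then quatj R else 1)
  else 0.
  by rewrite -signs_liftE -e mxE.
have nz (b : bool) : (if b then quatj R else 1) <> 0.
  by case: b => -[]/eqP; rewrite oner_eq0.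
have ep i : wperm v i = wperm w i.
  have := E i (wperm v i); rewrite eqxx; case: eqP => // _ /nz. by [].
case: v w E ep {e} => s e [s' e'] /= E ep; congr WCPair; first exact/permP.
apply/ffunP => i; have := E i (s i); rewrite ep !eqxx.
case: (mu2_valP (quat R) a i) => ->; rewrite ?mulN1r ?mul1r.
  by case: (e i); case: (e' i) => // -[] /eqP; rewrite ?oner_eq0 // eq_sym oner_eq0.
case: (e i); case: (e' i) => // -[] /eqP; rewrite ?oppr0 ?eqr_oppLR ?oppr0 ?oner_eq0 //.
  by rewrite eq_sym ?oner_eq0 ?oppr_eq0 oner_eq0.
Qed.

End ComplexForm.

(** * Generation of W(C_m) and the Tits group *)

Section Hyperoctahedral.
Variable m : nat.
Implicit Types (i k : 'I_m) (v w : WC m) (e : {ffun 'I_m -> bool}).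

(** Indexed like [chev_e]: [insub] fails exactly at the last index, that of the long root 2 eps_m,
    whose reflection is a sign change. *)
Definition simple_refl i : WC m :=
  if insub i.+1 is Some i' then WCPair (tperm i i') [ffun=> false]
  else WCPair 1 [ffun k => k == i].

(** The group (Z/2)^m is generated by its standard basis: restrict e to the indices in a list and
    let the list grow to the full enumeration. *)
Lemma ffun_bool_ind (P : {ffun 'I_m -> bool} -> Prop) :
  P [ffun=> false] ->
  (forall e e', P e -> P e' -> P [ffun i => e i (+) e' i]) ->
  (forall k, P [ffun i => i == k]) -> forall e, P e.
Proof.
move=> P0 PD P1 e.
have -> : e = [ffun i => (i \in enum 'I_m) && e i].
  by apply/ffunP => i; rewrite ffunE mem_enum.
elim: (enum _) (enum_uniq 'I_m) => [|k s IH] /=.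
  by move=> _; rewrite (_ : finfun _ = [ffun=> false]) //;
    apply/ffunP => i; rewrite !ffunE.
case/andP => ks /IH Ps; have [ek|ek] := boolP (e k).
  rewrite (_ : finfun _ = [ffun i => [ffun i => i == k] i (+)
    [ffun i => (i \in s) && e i] i]); first exact: PD.
  apply/ffunP => i; rewrite !ffunE inE; have [->|//] := eqVneq i k.
  by rewrite (negbTE ks) ek.
rewrite (_ : finfun _ = [ffun i => (i \in s) && e i]) //.
apply/ffunP => i; rewrite !ffunE inE; have [->|//] := eqVneq i k.
by rewrite (negbTE ek) !andbF.
Qed.

Section Generation.
Variable P : WC m -> Prop.
Hypotheses (P1 : P 1%g) (PM : forall v w, P v -> P w -> P (v * w)%g)
  (Ps : forall i, P (simple_refl i)).

Lemma WC_permM (s t : 'S_m) : P (WCPair s [ffun=> false]) ->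
  P (WCPair t [ffun=> false]) -> P (WCPair (s * t)%g [ffun=> false]).
Proof.
move=> Ps' Pt; rewrite (_ : WCPair _ _ =
  WCPair s [ffun=> false] * WCPair t [ffun=> false])%g.
  exact: PM.
by congr WCPair; apply/ffunP => i; rewrite !ffunE.
Qed.

(** Induction on the distance of the two indices: the transposition (i, k) is the conjugate of (i, k
    - 1) by the adjacent transposition (k - 1, k). *)
Lemma WC_tperm_lt d i k : k = (i + d.+1)%N :> nat -> P (WCPair (tperm i k) [ffun=> false]).
Proof.
have Psucc (j j' : 'I_m) : j' = j.+1 :> nat -> P (WCPair (tperm j j') [ffun=> false]).
  move=> jj'; have lt : (j.+1 < m)%N by rewrite -jj'.
  have := Ps j; rewrite /simple_refl (insubT (fun x => x < m)%N lt).
  by rewrite (_ : Sub _ _ = j') //; apply: val_inj; rewrite /= jj'.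
elim: d k => [|d IH] k ik; first by apply: Psucc; rewrite ik addn1.
have k'm : (i + d.+1 < m)%N by rewrite (leq_ltn_trans _ (ltn_ord k)) // ik leq_add2l.
pose k' := Ordinal k'm.
have -> : tperm i k = (tperm k' k * tperm i k' * tperm k' k)%g.
  have <- : (tperm i k' ^ tperm k' k)%g = tperm i k.
    rewrite tpermJ tpermL tpermD // -val_eqE /= ?ik; apply/eqP; lia.
  by rewrite conjgE tpermV mulgA.
have Pk : P (WCPair (tperm k' k) [ffun=> false]).
  by apply: Psucc; rewrite ik /= addnS.
by apply: WC_permM => //; apply: WC_permM => //; exact: IH.
Qed.

Lemma WC_perm s : P (WCPair s [ffun=> false]).
Proof.
have [ts -> tsD] := prod_tpermP s; elim: ts tsD => [|[i k] ts IH] /=.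
  by move=> _; rewrite big_nil.
case/andP => ik /IH; rewrite big_cons; apply: WC_permM.
rewrite /dpair /= in ik; case: (ltngtP i k) => [lt|lt|eq].
- by apply: (@WC_tperm_lt (k - i).-1);
    rewrite prednK ?subn_gt0 // subnKC // ltnW.
- by rewrite tpermC; apply: (@WC_tperm_lt (i - k).-1);
    rewrite prednK ?subn_gt0 // subnKC // ltnW.
- by rewrite (val_inj eq) eqxx in ik.
Qed.

(** The sign change at k is the conjugate, by the transposition of k and the last index, of the sign
    change at the last index, which is a simple reflection. *)
Lemma WC_sign e : P (WCPair 1 e).
Proof.
elim/ffun_bool_ind: e => [|e e' Pe Pe'|k]; first exact: WC_perm.
  rewrite (_ : WCPair _ _ = WCPair 1 e * WCPair 1 e')%g; first exact: PM.
  by congr WCPair; [rewrite mulg1|apply/ffunP => i; rewrite !ffunE perm1].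
(* The index k rules out m = 0, so a last index exists. *)
have m_gt0 : (m.-1 < m)%N by case: (m) k => [[]|].
pose last := Ordinal m_gt0.
have Pl : P (WCPair 1 [ffun i => i == last]).
  have := Ps last; rewrite /simple_refl insubF //=.
  by apply/negbTE; rewrite -leqNgt prednK //; case: (m) k => [[]|].
pose t := WCPair (tperm k last) [ffun=> false].
rewrite (_ : WCPair _ _ = t * WCPair 1 [ffun i => i == last] * t)%g.
  by apply: PM; [apply: PM => // |]; exact: WC_perm.
congr WCPair; first by rewrite /= mulg1 tperm2.
apply/ffunP => i; rewrite !ffunE addbF /=.
by rewrite (canF_eq (tpermK _ _)) tpermR.
Qed.

Lemma WC_generation w : P w.
Proof.
case: w => s e; rewrite (_ : WCPair _ _ = WCPair 1 e * WCPair s [ffun=> false])%g.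
  by apply: PM; [exact: WC_sign | exact: WC_perm].
by congr WCPair; [rewrite mul1g|apply/ffunP => i; rewrite !ffunE addbF].
Qed.

End Generation.
End Hyperoctahedral.

(** * The Tits group as the complex form of the preimage of W(C_m) *)

Section TitsGroup.
Variables (R : realType) (m : nat).
Implicit Types (i k : 'I_m) (w : WC m) (x : Wtilde R m) (y : sgtype (Sp R m)).

Lemma tits_genE i : let X := chev_f R i - chev_e R i in X ^+ 3 = - X ->
  tits_gen R i = 1 + X + X ^+ 2.
Proof.
move=> X X3; rewrite /tits_gen -/X mxexp_cubeN // sin_pihalf cos_pihalf subr0.
by rewrite !scale1r.
Qed.

(** With 1 + X + X^2 for the exponential, both sides are compared block by block. The sign on row i
    is dictated by X = f_i - e_i: the generator has the entry -1 at (i, i + 1) for a short root, and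
    -j at (i, i) in quaternionic form for the long one. *)
Lemma cform_tits_gen i :
  cform (uval (val (signs R (flip i) * monoj_lift R (simple_refl i))%g)) = tits_gen R i.
Proof.
pose X := chev_f R i - chev_e R i.
have XE k l := signs_liftE R (flip i) (simple_refl i) k l.
rewrite /cform; set U := uval _; rewrite -/U in XE; clearbody U.
move: XE; rewrite /simple_refl; case ins: (insub i.+1) => [i'|] /= XE; last first.
  (* Long root: X has the blocks -E and E off the diagonal, so X^2 is minus the projection onto the
     plane on which X is a rotation by a quarter turn. *)
  pose E : 'M[C R]_m := delta_mx i i.
  have EE : E *m E = E by rewrite mul_delta_mx.
  have XB : X = block_mx 0 (- E) E 0.
    rewrite /X /chev_f /chev_e ins tr_block_mx !trmx0 trmx_delta opp_block_mx.
    by rewrite add_block_mx !oppr0 !(addr0, add0r).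
  have X2 : X ^+ 2 = block_mx (- E) 0 0 (- E).
    rewrite expr2 -[_ * _]/(_ *m _) XB mulmx_block.
    by rewrite !(mul0mx, mulmx0, mulNmx, mulmxN, EE, add0r, addr0).
  rewrite tits_genE -/X; last first.
    rewrite exprS X2 -[_ * _]/(_ *m _) XB mulmx_block opp_block_mx.
    by rewrite !(mul0mx, mulmx0, mulNmx, mulmxN, EE, add0r, addr0, opprK, oppr0).
  rewrite X2 XB -[1]/(1%:M) scalar_mx_block !add_block_mx !add0r !addr0.
  have UE k l : U k l = if l == k then if k == i then - quatj R else 1 else 0.
    rewrite XE perm1 ffunE mu2_val_flip; case: (l == k) => //.
    by case: (k == i); rewrite ?mulN1r ?mulr1.
  have -> : re_mx U = 1%:M - E.
    apply/matrixP => k l; rewrite !mxE UE.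
    have [->|lk] := eqVneq l k; have [ki|ki] := eqVneq k i; rewrite ?ki ?eqxx /=.
    - by rewrite oppr0 subrr.
    - by rewrite subr0.
    - by rewrite -ki (negbTE lk) subrr.
    - by rewrite subrr.
  have -> : j_mx U = - E.
    apply/matrixP => k l; rewrite !mxE UE.
    have [->|lk] := eqVneq l k; have [ki|ki] := eqVneq k i; rewrite ?ki ?eqxx /=.
    - by rewrite rmorphN.
    - by rewrite oppr0.
    - by rewrite -ki (negbTE lk) oppr0.
    - by rewrite oppr0.
  by rewrite opprK.
(* Short root: X is block diagonal with the same skew-symmetric block D twice, so only D^3 = -D has
   to be checked. *)
have ii' : i' = i.+1 :> nat by case: insubP ins => // u _ <- [<-].
have ni : i != i' by rewrite -val_eqE /= ii' neq_ltn ltnSn.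
have ni' : i' != i by rewrite eq_sym.
pose D : 'M[C R]_m := delta_mx i' i - delta_mx i i'.
have D2 : D *m D = - (delta_mx i i + delta_mx i' i').
  rewrite /D mulmxBl !mulmxBr !mul_delta_mx !mul_delta_mx_0 //.
  by rewrite sub0r subr0 opprD addrC.
have D3 : D *m (D *m D) = - D.
  rewrite D2 mulmxN mulmxDr /D !mulmxBl !mul_delta_mx !mul_delta_mx_0 //.
  by rewrite sub0r subr0.
have XB : X = block_mx D 0 0 D.
  rewrite /X /chev_f /chev_e ins tr_block_mx !trmx0 linearN /= !trmx_delta opp_block_mx.
  by rewrite add_block_mx !oppr0 !addr0 opprK addrC /D [- _ + _]addrC.
have X2 : X ^+ 2 = block_mx (D *m D) 0 0 (D *m D).
  rewrite expr2 -[_ * _]/(_ *m _) XB mulmx_block.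
  by rewrite !(mul0mx, mulmx0, add0r, addr0).
rewrite tits_genE -/X; last first.
  rewrite exprS X2 -[_ * _]/(_ *m _) XB mulmx_block opp_block_mx.
  by rewrite !(mul0mx, mulmx0, add0r, addr0, oppr0) D3.
rewrite X2 XB -[1]/(1%:M) scalar_mx_block !add_block_mx !add0r.
have UE k l : U k l = if l == tperm i i' k then if k == i then -1 else 1 else 0.
  by rewrite XE ffunE mulr1 mu2_val_flip.
have -> : j_mx U = 0.
  apply/matrixP => k l; rewrite !mxE UE.
  by case: ifP => //; case: ifP => // _ _; rewrite /= oppr0.
have -> : re_mx U = 1%:M + D + D *m D.
  rewrite D2; apply/matrixP => k l; rewrite !mxE UE.
  case: tpermP => [->|->|/eqP ki /eqP ki'].
  - rewrite !eqxx (negbTE ni) /=; case: (eqVneq l i') => [->|li'].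
      by rewrite (negbTE ni) (negbTE ni') rmorphN /=; ring.
    rewrite eq_sym; case: (l == i); rewrite /=; ring.
  - rewrite !eqxx (negbTE ni') /=; case: (eqVneq l i) => [->|li].
      by rewrite (negbTE ni') (negbTE ni) /=; ring.
    rewrite eq_sym; case: (l == i'); rewrite /=; ring.
  - rewrite (negbTE ki) (negbTE ki') /= eq_sym; case: eqP => _ /=; ring.
by rewrite oppr0.
Qed.

Definition tits_lift x := exists2 y, sg_set (Tits R m) y & corresponds x y.

Lemma tits_liftM x x' : tits_lift x -> tits_lift x' -> tits_lift (x * x')%g.
Proof.
move=> [y Ty xy] [y' Ty' xy']; exists (y * y')%g; last exact: correspondsM.
exact: sg_mul.
Qed.

Lemma tits_lift1 : tits_lift 1%g.
Proof. by exists 1%g; [exact: sg_one | exact: corresponds1]. Qed.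

Lemma tits_lift_gen i : tits_lift (signs R (flip i) * monoj_lift R (simple_refl i))%g.
Proof.
have [y xy] := corresponds_ex (signs_lift_Rj R (flip i) (simple_refl i)).
exists y => // K; apply; exists i; rewrite -cform_tits_gen; exact: xy.2.
Qed.

Lemma tits_lift_WC w : exists2 x, tits_lift x & Wproj x = WSp_emb R w.
Proof.
elim/WC_generation: w => [|v w [x Lx xv] [x' Lx' xw]|i].
- exists 1%g; first exact: tits_lift1.
  by rewrite Wproj1 WSp_emb1.
- exists (x * x')%g; first exact: tits_liftM.
  by rewrite Wproj_morph xv xw WSp_emb_morph.
- exists (signs R (flip i) * monoj_lift R (simple_refl i))%g; first exact: tits_lift_gen.
  by rewrite -Wproj_lift; apply/Wproj_eq; exists (flip i).
Qed.

(** Any lift of the sign change at k is diagonal with entries 1 or -1, except for j or -j at k; its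
    square is the required sign matrix, whatever the signs of the lift. *)
Lemma tits_lift_flip k : tits_lift (signs R (flip k)).
Proof.
have [x Lx xk] := tits_lift_WC (WCPair 1 [ffun i => i == k]).
move: xk; rewrite -Wproj_lift => /Wproj_eq[a xE].
suff -> : signs R (flip k) = (x * x)%g by exact: tits_liftM.
apply/val_inj/units_eq; rewrite -[RHS]/(uval (val x) *m uval (val x)).
have -> : uval (val x) =
    diag_mx (\row_i (mu2_val (quat R) a i * if i == k then quatj R else 1)).
  apply/matrixP => i l; rewrite xE signs_liftE !mxE perm1 ffunE eq_sym.
  by case: eqP => _; rewrite ?mulr1n ?mulr0n.
rewrite mulmx_diag; congr diag_mx; apply/rowP => i; rewrite !mxE mu2_val_flip.
case: (mu2_valP (quat R) a i) => ->; case: eqP => _;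
  by rewrite ?mulN1r ?mul1r ?mulrNN ?mul1r; congr Quat; rewrite /=; ring.
Qed.

Lemma tits_lift_signs a : tits_lift (signs R a).
Proof.
(* The element a is rewritten through the indicator of its entries -1, so that [ffun_bool_ind]
   applies to that indicator. *)
have : tits_lift (signs R [ffun i => sgn_unit ([ffun i => uval (a i) == -1] i)]).
  elim/ffun_bool_ind: [ffun i => uval (a i) == -1] => [|e e' Le Le'|k].
  - rewrite (_ : finfun _ = 1%g); last by apply/ffunP => i; rewrite !ffunE.
    by rewrite (multiplicative1 (@signs R m)); exact: tits_lift1.
  - rewrite (_ : finfun _ = [ffun i => sgn_unit (e i)] * [ffun i => sgn_unit (e' i)])%g.
      by rewrite (signs_morph R); exact: tits_liftM.
    by apply/ffunP => i; rewrite !ffunE; case: (e i); case: (e' i); apply: units_eq.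
  - rewrite (_ : finfun _ = flip k); first exact: tits_lift_flip.
    by apply/ffunP => i; rewrite !ffunE.
rewrite (_ : finfun _ = a) //; apply/ffunP => i; rewrite !ffunE.
by apply: units_eq; case: (units_intP (a i)) => ->.
Qed.

Lemma tits_lift_all x : (exists w, Wproj x = WSp_emb R w) -> tits_lift x.
Proof.
case=> w; have [x' Lx' <-] := tits_lift_WC w; case/Wproj_eq => a ->.
by apply: tits_liftM => //; exact: tits_lift_signs.
Qed.

(** The elements y with the stated property form a subgroup K containing the generators, hence K
    contains the subgroup they generate. *)
Lemma tits_corresponds y : sg_set (Tits R m) y ->
  exists x, corresponds x y /\ exists w, Wproj x = WSp_emb R w.
Proof.
pose K : set (sgtype (Sp R m)) :=
  [set y | exists x, corresponds x y /\ exists w, Wproj x = WSp_emb R w].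
have K1 : K 1%g.
  exists 1%g; split; first exact: corresponds1.
  by exists 1%g; rewrite Wproj1 WSp_emb1.
have KM u v : K u -> K v -> K (u * v)%g.
  move=> [x [xu [w xw]]] [x' [xv [w' xw']]]; exists (x * x')%g.
  split; first exact: correspondsM.
  by exists (w * w')%g; rewrite Wproj_morph xw xw' WSp_emb_morph.
have KV u : K u -> K u^-1%g.
  move=> [x [xu [w xw]]]; exists x^-1%g; split; first exact: correspondsV.
  exists w^-1%g.
  by rewrite WprojV WSp_embV xw.
apply: (_ : _ -> sg_set (Subgroup K1 KM KV) y); apply=> {}y [i yi].
exists (signs R (flip i) * monoj_lift R (simple_refl i))%g; split.
  by split; [exact: signs_lift_Rj | rewrite cform_tits_gen].
exists (simple_refl i); rewrite -Wproj_lift; apply/Wproj_eq; by exists (flip i).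
Qed.

Lemma mul_block_diag (K : pzSemiRingType) (p : nat) (A B A' B' D D' : 'M[K]_p) :
  block_mx A B A' B' *m block_mx D 0 0 D' =
  block_mx (A *m D) (B *m D') (A' *m D) (B' *m D').
Proof. by rewrite mulmx_block !mulmx0 !addr0 !add0r. Qed.

Lemma mul_diag_block (K : pzSemiRingType) (p : nat) (A B A' B' D D' : 'M[K]_p) :
  block_mx D 0 0 D' *m block_mx A B A' B' =
  block_mx (D *m A) (D *m B) (D' *m A') (D' *m B').
Proof. by rewrite mulmx_block !mul0mx !addr0 !add0r. Qed.

Lemma cform_torus a w (t : 'I_m -> C R) :
  let X := cform (uval (val (signs R a * monoj_lift R w)%g)) in
  X *m torus_mx t = torus_mx (WC_act w t) *m X.
Proof.
have UE k l := signs_liftE R a w k l.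
move=> X; rewrite {}/X; set U := uval _; rewrite -/U in UE; clearbody U.
rewrite /cform.
(* The real block is supported on the rows without sign change and the j block on the rows with one.
   The torus relation then splits into four block identities, each checked on the support of its
   block. *)
have reE k l : re_mx U k l != 0 -> l = wperm w k /\ ~~ wsign w k.
  rewrite mxE UE; case: (l =P _) => [->|_]; last by rewrite eqxx.
  case: (wsign w k) => //; rewrite mu2_valC.
  by case: (mu2_valP (quat R) a k) => ->; rewrite ?mulrN1 ?mulr1 /= ?oppr0 eqxx.
have jE k l : j_mx U k l != 0 -> l = wperm w k /\ wsign w k.
  rewrite mxE UE; case: (l =P _) => [->|_]; last by rewrite eqxx.
  case: (wsign w k) => //; rewrite mu2_valC.
  by case: (mu2_valP (quat R) a k) => ->; rewrite ?mulrN1 ?mulr1 /= ?oppr0 eqxx.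
move: (re_mx U) (j_mx U) reE jE => A B AE BE {U UE}.
have diagE (Z : 'M[C R]_m) (d d' : 'rV[C R]_m) :
    (forall k l, Z k l != 0 -> d 0 l = d' 0 k) ->
    Z *m diag_mx d = diag_mx d' *m Z.
  move=> dd'; apply/matrixP => k l; rewrite mul_mx_diag mul_diag_mx !mxE mulrC.
  by have [->|/dd' ->//] := eqVneq (Z k l) 0; rewrite !mulr0.
pose T := \row_i t i; pose TV := \row_i (t i)^-1.
pose S := \row_i WC_act w t i; pose SV := \row_i (WC_act w t i)^-1.
have e1 : A *m diag_mx T = diag_mx S *m A.
  by apply: diagE => k l /AE[-> /negbTE e]; rewrite !mxE /WC_act e.
have e2 : B *m diag_mx TV = diag_mx S *m B.
  by apply: diagE => k l /BE[-> e]; rewrite !mxE /WC_act e.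
have e3 : - B *m diag_mx T = diag_mx SV *m - B.
  apply: diagE => k l; rewrite mxE oppr_eq0 => /BE[-> e].
  by rewrite !mxE /WC_act e invrK.
have e4 : A *m diag_mx TV = diag_mx SV *m A.
  by apply: diagE => k l /AE[-> /negbTE e]; rewrite !mxE /WC_act e.
rewrite /torus_mx -/T -/TV -/S -/SV; move: T TV S SV e1 e2 e3 e4.
move=> T TV S SV e1 e2 e3 e4.
by rewrite mul_block_diag mul_diag_block e1 e2 e3 e4.
Qed.

Lemma cform_signs (a : mu2n m) :
  cform (uval (val (signs R a))) = torus_mx (mu2_val (C R) a).
Proof.
rewrite /cform /torus_mx; congr block_mx; apply/matrixP => k l; rewrite !mxE.
- have [->|_] := eqVneq k l; rewrite ?mulr1n ?mulr0n // /mu2_val.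
  by case: (units_intP (a l)) => ->; rewrite ?rmorphN1 /= ?rmorphN1.
- have [->|_] := eqVneq k l; rewrite ?mulr1n ?mulr0n // /mu2_val.
  by case: (units_intP (a l)) => ->; rewrite ?rmorphN1 /= ?oppr0.
- have [->|_] := eqVneq k l; rewrite ?mulr1n ?mulr0n ?oppr0 // /mu2_val.
  by case: (units_intP (a l)) => ->; rewrite ?rmorphN1 /= ?oppr0.
- have [->|_] := eqVneq k l; rewrite ?mulr1n ?mulr0n // /mu2_val.
  by case: (units_intP (a l)) => ->; rewrite ?rmorphN1 /= ?invrN ?invr1 ?rmorphN1.
Qed.

End TitsGroup.

(** * The Tits extension as a restriction of the quaternionic one *)

Section TitsExtension.
Variables (R : realType) (m : nat).
Implicit Types (y : WT R m) (w : WC m) (a : mu2n m).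

(** The lift is picked by choice, but [corresponds_inj] makes it unique, which is why [tits_emb] is
    a morphism. Likewise the choice in [tits_proj] is unique by [WSp_emb_inj], and that in
    [tits_signs] by [tits_emb_inj]. *)
Let Tits_corr y := cid (tits_corresponds (set_mem (valP y))).

Definition tits_emb y : Wtilde R m := projT1 (Tits_corr y).

Lemma tits_embP y : corresponds (tits_emb y) (val y).
Proof. by rewrite /tits_emb; case: (Tits_corr y) => x []. Qed.

Lemma tits_emb_WC y : exists w, Wproj (tits_emb y) = WSp_emb R w.
Proof. by rewrite /tits_emb; case: (Tits_corr y) => x []. Qed.

Definition tits_proj y : WC m := projT1 (cid (tits_emb_WC y)).

Lemma tits_projP y : Wproj (tits_emb y) = WSp_emb R (tits_proj y).
Proof. by rewrite /tits_proj; case: cid. Qed.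

Fact tits_emb_morph : {morph tits_emb : y z / (y * z)%g}.
Proof.
move=> y z; apply: corresponds_inj (tits_embP _) _.
have -> : val (y * z)%g = (val y * val z)%g by [].
exact: correspondsM (tits_embP y) (tits_embP z).
Qed.
HB.instance Definition _ :=
  isMultiplicative.Build (WT R m) (Wtilde R m) tits_emb tits_emb_morph.

Fact tits_proj_morph : {morph tits_proj : y z / (y * z)%g}.
Proof.
move=> y z; apply: (@WSp_emb_inj R).
by rewrite -tits_projP tits_emb_morph Wproj_morph !tits_projP WSp_emb_morph.
Qed.
HB.instance Definition _ :=
  isMultiplicative.Build (WT R m) (WC m) tits_proj tits_proj_morph.

Lemma tits_emb_inj : injective tits_emb.
Proof.
move=> y z e; apply: val_inj; apply: corresponds_fun (tits_embP y) _.
by rewrite e; exact: tits_embP.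
Qed.

Lemma tits_emb_image x : (exists y, tits_emb y = x) <-> exists w, Wproj x = WSp_emb R w.
Proof.
split=> [[y <-]|/tits_lift_all[y Ty xy]]; first exact: tits_emb_WC.
pose z : WT R m := exist (fun g => g \in sg_set (Tits R m)) y (mem_set Ty).
by exists z; exact: corresponds_inj (tits_embP z) xy.
Qed.

Lemma tits_signs_ex a : exists y, tits_emb y = signs R a.
Proof.
apply/tits_emb_image; exists 1%g; rewrite WSp_emb1.
by apply/Wproj_eq1; exists a.
Qed.

Definition tits_signs a : WT R m := projT1 (cid (tits_signs_ex a)).

Lemma tits_signsP a : tits_emb (tits_signs a) = signs R a.
Proof. by rewrite /tits_signs; case: cid. Qed.

Fact tits_signs_morph : {morph tits_signs : a b / (a * b)%g}.
Proof.
by move=> a b; apply: tits_emb_inj; rewrite tits_emb_morph !tits_signsP signs_morph.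
Qed.
HB.instance Definition _ :=
  isMultiplicative.Build (mu2n m) (WT R m) tits_signs tits_signs_morph.

(** Exactness is inherited from the extension by [Wtilde] through the injections [tits_emb] and
    [WSp_emb]; the two matrix conditions are read off complex forms. *)
Lemma tits_extension : is_tits_extension tits_signs tits_proj.
Proof.
split.
- split=> [a b /(congr1 tits_emb)|w|y].
  + by rewrite !tits_signsP => /signs_inj.
  + have [|y yw] := (tits_emb_image (monoj_lift R w)).2; first by exists w; exact: Wproj_lift.
    by exists y; apply: (@WSp_emb_inj R); rewrite -tits_projP yw Wproj_lift.
  + split=> [y1|[a <-]].
      have /Wproj_eq1[a ay] : Wproj (tits_emb y) = 1%g.
        by rewrite tits_projP y1 WSp_emb1.
      by exists a; apply: tits_emb_inj; rewrite tits_signsP.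
    apply: (@WSp_emb_inj R); rewrite -tits_projP tits_signsP.
    by rewrite WSp_emb1; apply/Wproj_eq1; exists a.
- by move=> a; rewrite /WT_mx (tits_embP _).2 tits_signsP cform_signs.
- move=> y t _; rewrite /WT_mx (tits_embP y).2.
  have := tits_projP y; rewrite -Wproj_lift => /Wproj_eq[a ->].
  exact: cform_torus.
Qed.

Lemma tits_restriction :
  is_restriction (@WSp_emb R m) (@signs R m) (@Wproj R m) tits_signs tits_proj.
Proof.
exists tits_emb; split; [exact: tits_emb_inj | exact: tits_emb_image
  | exact: tits_signsP | exact: tits_projP].
Qed.

End TitsExtension.

Theorem proposition7p1 (R : realType) (l : nat) :
  exists (Wt : groupType) (i : {multiplicative mu2n l.+1 -> Wt})
    (p : {multiplicative Wt -> WGLH R l.+1})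
    (iota : {multiplicative Wt -> GLH R l.+1}),
    [/\ is_extension i p,
        injective iota,
        forall x, normalizes (diagH R l.+1) (iota x) /\
          induced_by (iota x) (val (p x))
      & exists (iT : {multiplicative mu2n l.+1 -> WT R l.+1})
          (pT : {multiplicative WT R l.+1 -> WC l.+1}),
          is_tits_extension iT pT /\
          is_restriction (WSp_emb R (m := l.+1)) i p iT pT].
Proof.
exists (Wtilde R l.+1), (@signs R l.+1), (@Wproj R l.+1), val; split.
- by split; [exact: signs_inj | exact: Wproj_surj | exact: Wproj_eq1].
- exact: val_inj.
- by move=> x; split=> [|h]; [exact: Wtilde_normalizes|].
- exists (@tits_signs R l.+1), (@tits_proj R l.+1).
  by split; [exact: tits_extension | exact: tits_restriction].
Qed.
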